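(* Let $f$ be a smooth real function on $(0,\infty)$. Then $f$ is operator absolutely monotone on $(0,\infty)$ if and only if $f(x)=\alpha x+\beta$ with $\alpha,\beta\ge0$. Also, $f$ is operator completely monotone on $(0,\infty)$ if and only if $f$ is a non-negative operator monotone decreasing function on $(0,\infty)$.
   Context: $\mathbb{M}_n^{sa}(a,b)$ is the set of $n\times n$ Hermitian matrices with eigenvalues in $(a,b)$; $\mathbb{M}_n^+$ the set of $n\times n$ positive semidefinite matrices. A smooth ($C^\infty$) real function $f$ on $(a,b)$ is operator absolutely monotone (resp. operator completely monotone) if $$\frac{d^k}{dt^k}f(A+tX)\Big|_{t=0}\ge0\quad\Bigl(\text{resp. }(-1)^k\frac{d^k}{dt^k}f(A+tX)\Big|_{t=0}\ge0\Bigr),\qquad k=0,1,2,\dots,$$ for every $A\in\mathbb{M}_n^{sa}(a,b)$ and every $X\in\mathbb{M}_n^+$, for any $n\in\mathbb{N}$. A function $f$ is operator monotone decreasing on $(0,\infty)$ if $A\le B$ implies $f(A)\ge f(B)$ for all self-adjoint $A,B$ (equivalently, Hermitian matrices of every size) with spectra in $(0,\infty)$. *)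

(* Defs.v *)
From HB Require Import structures.
From mathcomp Require Import all_boot all_order all_algebra sesquilinear spectral.
From mathcomp Require Import all_classical all_reals all_analysis.
From mathcomp Require Import complex.

Set Implicit Arguments.
Unset Strict Implicit.
Unset Printing Implicit Defensive.

Import Order.TTheory GRing.Theory Num.Theory.
Import numFieldNormedType.Exports.

Local Open Scope ring_scope.
Local Open Scope complex_scope.
Local Open Scope sesquilinear_scope.

(* Throughout, [I] is an open interval, and only the values of [f : R -> R] on
   [I] are relevant: for [A] Hermitian with spectrum in [I], so is [A + t X] for
   all [t] near 0. *)

Definition smooth_on (R : realType) (I : interval R) (f : R -> R) : Prop :=
  forall (k : nat) (x : R), x \in I -> derivable (derive1n k f) x 1.

Definition herm_spec_in (R : realType) (I : interval R) (n : nat)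
    (A : 'M[R[i]]_n) : Prop :=
  A \is hermsymmx /\
  forall a : R[i], eigenvalue A a -> exists2 x : R, x \in I & a = x%:C.

(* In R[i], [0 <= z] means that z is real and nonnegative. *)
Definition psdmx (R : realType) (n : nat) (A : 'M[R[i]]_n) : Prop :=
  A \is hermsymmx /\
  forall u : 'rV[R[i]]_n, 0 <= (u *m A *m u^t*) 0 0.

Definition loewner_le (R : realType) (n : nat) (A B : 'M[R[i]]_n) : Prop :=
  psdmx (B - A).

(* For [A] Hermitian, A = P^-1 diag(d) P with P := spectralmx A unitary and
   d := spectral_diag A real, and f(A) := P^-1 diag(f(d)) P. *)
Definition mxfun (R : realType) (f : R -> R) (n : nat)
    (A : 'M[R[i]]_n) : 'M[R[i]]_n :=
  let P := spectralmx A in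
  invmx P
    *m diag_mx (map_mx (fun z : R[i] => (f (complex.Re z))%:C) (spectral_diag A))
    *m P.

(* R[i] carries no normed R-module structure in the library, so the k-th
   derivative of a matrix-valued curve is taken on the real and imaginary parts
   of its entries. *)
Definition mxderive1n (R : realType) (n k : nat) (F : R -> 'M[R[i]]_n) (t : R) :
    'M[R[i]]_n :=
  \matrix_(i, j)
    (derive1n k (fun s => complex.Re (F s i j)) t
     +i* derive1n k (fun s => complex.Im (F s i j)) t).

Definition op_absolutely_monotone (R : realType) (I : interval R)
    (f : R -> R) : Prop :=
  forall (n : nat) (A X : 'M[R[i]]_n), herm_spec_in I A -> psdmx X ->
  forall k : nat, psdmx (mxderive1n k (fun t => mxfun f (A + t%:C *: X)) 0).

Definition op_completely_monotone (R : realType) (I : interval R)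
    (f : R -> R) : Prop :=
  forall (n : nat) (A X : 'M[R[i]]_n), herm_spec_in I A -> psdmx X ->
  forall k : nat,
    psdmx ((-1) ^+ k *: mxderive1n k (fun t => mxfun f (A + t%:C *: X)) 0).

Definition op_monotone_decreasing (R : realType) (I : interval R)
    (f : R -> R) : Prop :=
  forall (n : nat) (A B : 'M[R[i]]_n), herm_spec_in I A -> herm_spec_in I B ->
  loewner_le A B -> loewner_le (mxfun f B) (mxfun f A).

(* Main.v *)
Require Import Defs.
From mathcomp Require Import all_boot all_order all_algebra.
From mathcomp Require Import all_classical all_reals all_analysis.
From mathcomp Require Import sesquilinear spectral complex ring lra.

Import Order.TTheory GRing.Theory Num.Theory.
Import numFieldNormedType.Exports.

Set Implicit Arguments.
Unset Strict Implicit.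
Unset Printing Implicit Defensive.

Local Open Scope ring_scope.
Local Open Scope sesquilinear_scope.

(** Matrix functions are studied through the real curves
    [phi t = u f(A + t X) u^*], one for each row vector [u]; by polarization they
    carry the same information as the entries of [f(A + t X)].

    First order. Hermite interpolation of [f] on the spectrum of [A] replaces [f]
    by a polynomial up to a function flat on the spectrum, and the eigenvalues of
    [A + t X] stay within [O(t)] of those of [A]. So [phi] is derivable as soon as
    [f] is ([mxfun_curve_deriv]), and for diagonal [A] its derivative is the form
    of the Loewner matrix of [f]. By the mean value theorem the condition [k = 1]
    makes [f] operator monotone ([monotone_of_deriv]), while [k = 0] gives
    [0 <= f]. This settles one half of the second equivalence.

    Absolute monotonicity. An operator increasing function on the half-line is
    midpoint concave ([op_increasing_midconcave]), and matrices of size one with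
    [k = 2] give [0 <= f'']. A convex and midpoint concave function is affine
    ([convex_midconcave_affine]); its coefficients are nonnegative because [f] is.

    From decreasing to completely monotone, without an integral representation.
    Let [g x = f (x + d)] for a small [d > 0]. The Loewner matrices of [- g] and of
    [x g(x)] are positive semidefinite ([loewner_decreasing], [loewner_mul_id]);
    the second is where [0 <= f] enters. A simultaneous diagonalization of the two
    produces, for any finite set of nodes, a function
    [r x = \sum_k w_k / (x d_k + 1 - d_k)] with [0 <= w_k] and [0 <= d_k <= 1] that
    agrees with [g] at the nodes ([rational_interpolation]). Taking as nodes the
    eigenvalues of finitely many [A - d + t X] makes [phi] agree, at the
    corresponding [t], with a form of [r(A - d + t X)]. Each summand of that form
    is a sum of kernels [c / (1 + t y)], [0 <= c], [0 <= y <= K], with [K] depending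
    on [A] and [X] only ([resolvent_kernel]). Such sums have derivatives of sign
    [(-1)^k], and their derivatives of every order are bounded uniformly near [0]
    once their value at [0] is prescribed. So along the filter of finite sets of
    points they converge to [phi] with all their derivatives, and [phi] is smooth
    with derivatives of the right sign ([kernel_interpolation_deriv]). *)

(** * Matrix notions over an abstract field of complex numbers *)

(** The complex numbers over [R], presented by their real and imaginary parts. As
    the field stays a variable, each algebraic operation on matrices over it comes
    from the closed field structure alone, whereas the concrete [R[i]] reaches the
    same operations through several instances that are costly to compare. *)
Record complex_model (R : realType) := ComplexModel {
  cplx :> numClosedFieldType;
  creal : {rmorphism R -> cplx};
  cre : {additive cplx -> R};
  cim : {additive cplx -> R};
  cpair : R -> R -> cplx;
  conj_creal : forall x : R, (creal x)^* = creal x;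
  crealK : forall x : R, cre (creal x) = x;
  creM : forall (x : R) (z : cplx), cre (creal x * z) = x * cre z;
  creMc : forall w z : cplx, cre (w * z) = cre w * cre z - cim w * cim z;
  cre_conj : forall z : cplx, cre z^* = cre z;
  cim_conj : forall z : cplx, cim z^* = - cim z;
  cplx_eqP : forall w z : cplx, cre w = cre z -> cim w = cim z -> w = z;
  real_cre : forall z : cplx, z \is Num.real -> creal (cre z) = z;
  creal_ge0 : forall x : R, (0 <= creal x) = (0 <= x);
  cre_cpair : forall x y : R, cre (cpair x y) = x;
  cim_cpair : forall x y : R, cim (cpair x y) = y
}.
Arguments creal {R c}.
Arguments cre {R c}.
Arguments cim {R c}.
Arguments cpair {R c}.
Arguments conj_creal {R c}.
Arguments cplx_eqP {R c}.
Arguments real_cre {R c}.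

Section model_notions.
Variables (R : realType) (cc : complex_model R).
Local Notation C := (cplx cc).

Lemma creal_inj : injective (@creal R cc).
Proof. by move=> x y h; rewrite -(crealK cc x) h crealK. Qed.

Lemma cre_ge0 (z : C) : 0 <= z -> 0 <= cre z.
Proof. by move=> h; rewrite -(creal_ge0 cc) real_cre // ger0_real. Qed.

(** [cherm], [cpsd], [cspec], [cmxfun] and [cmxderive1n] transpose [hermsymmx],
    [psdmx], [herm_spec_in], [mxfun] and [mxderive1n] to a model. *)
Definition cherm n (A : 'M[C]_n) := A^t* = A.

Definition cpsd n (A : 'M[C]_n) :=
  cherm A /\ forall u : 'rV[C]_n, 0 <= (u *m A *m u^t*) 0 0.

Definition cspec (I : interval R) n (A : 'M[C]_n) :=
  cherm A /\ forall a, eigenvalue A a -> exists2 x : R, x \in I & a = creal x.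

Definition cmxfun (f : R -> R) n (A : 'M[C]_n) : 'M[C]_n :=
  invmx (spectralmx A)
    *m diag_mx (map_mx (fun z => creal (f (cre z))) (spectral_diag A))
    *m spectralmx A.

Definition cmxderive1n n k (F : R -> 'M[C]_n) (t : R) : 'M[C]_n :=
  \matrix_(i, j) cpair (derive1n k (fun s => cre (F s i j)) t)
                       (derive1n k (fun s => cim (F s i j)) t).

Lemma cre_mxderive1n n k (F : R -> 'M[C]_n) t i j :
  cre (cmxderive1n k F t i j) = derive1n k (fun s => cre (F s i j)) t.
Proof. by rewrite mxE cre_cpair. Qed.

Lemma cim_mxderive1n n k (F : R -> 'M[C]_n) t i j :
  cim (cmxderive1n k F t i j) = derive1n k (fun s => cim (F s i j)) t.
Proof. by rewrite mxE cim_cpair. Qed.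

Lemma chermE n (A : 'M[C]_n) : cherm A <-> A \is hermsymmx.
Proof.
split=> [h|/is_hermitianmxP]; last first.
  by rewrite expr0 scale1r => h; exact: esym h.
by apply/is_hermitianmxP; rewrite expr0 scale1r; exact: esym h.
Qed.

Definition absolutely_monotone_over (I : interval R) f :=
  forall n (A X : 'M[C]_n), cspec I A -> cpsd X -> forall k,
  cpsd (cmxderive1n k (fun t => cmxfun f (A + creal t *: X)) 0).

Definition completely_monotone_over (I : interval R) f :=
  forall n (A X : 'M[C]_n), cspec I A -> cpsd X -> forall k,
  cpsd (creal ((-1) ^+ k) *: cmxderive1n k (fun t => cmxfun f (A + creal t *: X)) 0).

Definition monotone_decreasing_over (I : interval R) f :=
  forall n (A B : 'M[C]_n), cspec I A -> cspec I B -> cpsd (B - A) ->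
  cpsd (cmxfun f A - cmxfun f B).

End model_notions.


(** * Derivatives of real functions *)

Section scalar.
Local Open Scope classical_set_scope.
Variable R : realType.
Implicit Types (f g : R -> R) (x t c l : R).

Lemma is_derive_epsP f x l :
  is_derive x 1 f l <->
  (forall e : R, 0 < e -> exists2 d : R, 0 < d &
     forall h, `|h| < d -> `|f (x + h) - f x - h * l| <= e * `|h|).
Proof.
have E : (is_derive x 1 f l) <->
    ((fun h => h^-1 *: (f (h *: 1 + x) - f x)) @ 0^' --> l).
  split=> [[df <-] //|H].
  by apply: DeriveDef; [apply/cvg_ex; exists l | apply: cvg_lim].
have F h : h != 0 -> `|l - h^-1 *: (f (h *: 1 + x) - f x)| * `|h| =
    `|f (x + h) - f x - h * l|.
  move=> h0; rewrite -normrM -normrN; congr `|_|.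
  rewrite /GRing.scale /= mulr1 (addrC h x) mulrBl opprB.
  by rewrite mulrAC mulVf // mul1r (mulrC l).
rewrite E; split=> [/cvgrPdist_le H e e0|H].
  have /nbhs_normP [d d0 hd] := H e e0; exists d => // h hd'.
  have [->|h0] := eqVneq h 0; first by rewrite addr0 mul0r !subrr normr0 mulr0.
  rewrite -F // ler_wpM2r //; apply: hd => //.
  by rewrite /ball_ /= sub0r normrN.
apply/cvgrPdist_le => e e0; have [d d0 hd] := H e e0.
apply/nbhs_normP; exists d => // h; rewrite /ball_ /= sub0r normrN => hd' h0.
by have := hd _ hd'; rewrite -F // ler_pM2r // normr_gt0.
Qed.

Lemma is_derive_right_ge0 f x l : is_derive x 1 f l ->
  (exists2 d, 0 < d & forall h, 0 < h < d -> f x <= f (x + h)) -> 0 <= l.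
Proof.
move=> /is_derive_epsP H [d d0 hd]; rewrite leNgt; apply/negP => l0.
have [d' d'0 hd'] := H (- l / 2) ltac:(lra).
pose h := Num.min d d' / 2.
have hm : 0 < Num.min d d' by rewrite lt_min d0.
have [h1 h2] : h < d /\ h < d'.
  by have := ge_min d d d'; have := ge_min d' d d'; rewrite !lexx ?orbT /h; lra.
have h0 : 0 < h by rewrite /h; lra.
have := hd' h; rewrite gtr0_norm // => /(_ h2); rewrite ler_norml => /andP[_].
have := hd h; rewrite h0 h1 => /(_ isT); nra.
Qed.

(** The derivatives below order [k] are required on a whole neighbourhood of
    [0], so that [derive1n] is the iterated derivative in the usual sense. *)
Definition kth_deriv k f c := exists2 r : R, 0 < r &
  exists psi : nat -> R -> R,
    [/\ forall t, `|t| < r -> psi 0%N t = f t,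
        forall j t, (j < k)%N -> `|t| < r -> is_derive t 1 (psi j) (psi j.+1 t)
      & psi k 0 = c].

Lemma near_norm_lt (r : R) t : `|t| < r -> \forall s \near t, `|s| < r.
Proof.
move=> tr; apply/nbhs_normP; exists (r - `|t|); first by rewrite /= subr_gt0.
move=> s /=; rewrite /ball_ /= => h.
have := ler_normB t (t - s); rewrite opprB addrCA subrr addr0; lra.
Qed.

Lemma kth_derivE k f c : kth_deriv k f c -> derive1n k f 0 = c.
Proof.
move=> [r r0 [psi [h0 hd <-]]].
suff H j : (j <= k)%N -> forall t, `|t| < r -> derive1n j f t = psi j t.
  by apply: H => //; rewrite normr0.
elim: j => [_ t tr|j IH jk t tr]; first by rewrite h0.
rewrite derive1nS derive1E.
have -> : 'D_1 (derive1n j f) t = 'D_1 (psi j) t.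
  apply: near_eq_derive; apply: filterS (near_norm_lt tr) => s sr.
  by rewrite IH // ltnW.
by have [] := hd j t jk tr.
Qed.

Lemma kth_deriv_ext k f g c (r : R) : 0 < r -> (forall t, `|t| < r -> f t = g t) ->
  kth_deriv k f c -> kth_deriv k g c.
Proof.
move=> r0 fg [s s0 [psi [h0 hd hc]]]; exists (Num.min r s); first by rewrite lt_min r0.
exists psi; split=> // [t|j t jk]; rewrite lt_min => /andP[t1 t2].
  by rewrite h0 // fg.
exact: hd.
Qed.

Lemma kth_derivD k f g c d : kth_deriv k f c -> kth_deriv k g d ->
  kth_deriv k (fun t => f t + g t) (c + d).
Proof.
move=> [r r0 [psi [h0 hd hc]]] [s s0 [psi' [h0' hd' hc']]].
exists (Num.min r s); first by rewrite lt_min r0.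
exists (fun j t => psi j t + psi' j t); split=> [t|j t jk|].
- by rewrite lt_min => /andP[t1 t2]; rewrite h0 // h0'.
- rewrite lt_min => /andP[t1 t2].
  by have := hd j t jk t1; have := hd' j t jk t2 => ? ?; apply: is_deriveD.
- by rewrite hc hc'.
Qed.

Lemma kth_derivZ k f c a : kth_deriv k f c ->
  kth_deriv k (fun t => a * f t) (a * c).
Proof.
move=> [r r0 [psi [h0 hd hc]]]; exists r => //.
exists (fun j t => a * psi j t); split=> [t tr|j t jk tr|].
- by rewrite h0.
- by have := hd j t jk tr => ?; apply: is_deriveZ.
- by rewrite hc.
Qed.

Lemma kth_deriv_sum k (I : Type) (s : seq I) (F : I -> R -> R) (c : I -> R) :
  (forall i, kth_deriv k (F i) (c i)) ->
  kth_deriv k (fun t => \sum_(i <- s) F i t) (\sum_(i <- s) c i).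
Proof.
move=> H; elim: s => [|i s IH].
  exists 1 => //; exists (fun _ _ => 0); split=> // [t _|j t _ _|].
  - by rewrite big_nil.
  - exact: is_derive_cst.
  - by rewrite big_nil.
rewrite big_cons.
apply: (@kth_deriv_ext _ (fun t => F i t + \sum_(j <- s) F j t) _ _ 1) => //.
  by move=> t _; rewrite big_cons.
exact: kth_derivD.
Qed.

(** The Taylor bound makes a difference quotient of [g k i] with step [h] close to
    [g k.+1 i], up to [C k * h] for all [i] simultaneously. Hence convergence at order
    [k] makes order [k.+1] Cauchy, and the bound itself passes to the limit. The
    filter is arbitrary, so that it can be one of finite sets of points. *)
Lemma derivative_of_limit (I : Type) (F : set_system I) (FF : ProperFilter F)
    (g : nat -> I -> R -> R) (phi : R -> R) (r : R) (C : nat -> R) :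
  (forall k t s, `|t| < r -> `|s| < r -> \forall i \near F,
     `|g k i t - g k i s - (t - s) * g k.+1 i s| <= C k * (t - s) ^+ 2) ->
  (forall t, `|t| < r -> g 0%N i t @[i --> F] --> phi t) ->
  exists psi : nat -> R -> R, [/\ forall t, `|t| < r -> psi 0%N t = phi t,
    forall k t, `|t| < r -> g k i t @[i --> F] --> psi k t &
    forall k t, `|t| < r -> is_derive t 1 (psi k) (psi k.+1 t)].
Proof.
move=> hT h0; pose psi k t : R := lim (g k i t @[i --> F]).
have room (s : R) : `|s| < r -> exists2 d : R, 0 < d & forall h : R, `|h| < d -> `|s + h| < r.
  move=> sr; exists (r - `|s|); first by rewrite subr_gt0.
  by move=> h hd; have := ler_normD s h; lra.
have cv k t : `|t| < r -> g k i t @[i --> F] --> psi k t.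
  elim: k t => [|k IH] s sr; first by have := h0 s sr; move/cvgP.
  suff : cauchy (g k.+1 i s @[i --> F]) by move=> /cauchy_cvg.
  apply: cauchy_exP => e e0.
  have [d d0 hd] := room s sr.
  pose c := `|C k| + 1; have c0 : 0 < c by rewrite /c; have := normr_ge0 (C k); lra.
  (* A step inside the domain for which the Taylor error is below [e / 4]. *)
  pose h := Num.min (d / 2) (e / (4 * c)).
  have m0 : 0 < h.
    by rewrite lt_min divr_gt0 //= divr_gt0 // mulr_gt0.
  have hd2 : h <= d / 2 by rewrite ge_min lexx.
  have he : h * c <= e / 4.
    have : h <= e / (4 * c) by rewrite ge_min lexx orbT.
    rewrite ler_pdivlMr ?mulr_gt0 //; nra.
  have shr : `|s + h| < r by apply: hd; rewrite gtr0_norm //; lra.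
  exists (h^-1 * (psi k (s + h) - psi k s)).
  have q : h^-1 * (g k i (s + h) - g k i s) @[i --> F] -->
     h^-1 * (psi k (s + h) - psi k s).
    by apply: cvgM; [apply: cvg_cst|apply: cvgB; apply: IH].
  have := @cvgr_dist_lt _ _ _ F _ _ _ q (e / 2) ltac:(lra).
  have := hT k _ _ shr sr; apply: filterS2 => i.
  rewrite /ball /= (_ : s + h - s = h); last by ring.
  set a := g k i (s + h) - g k i s; set b := psi k _ - _; set z := g _ _ _.
  move=> A B.
  have A' : `|h^-1 * a - z| <= e / 4.
    rewrite (_ : h^-1 * a - z = h^-1 * (a - h * z)); last first.
      by rewrite [RHS]mulrBr [h^-1 * (h * z)]mulrA mulVf ?gt_eqF // mul1r.
    rewrite normrM gtr0_norm ?invr_gt0 // mulrC ler_pdivrMr //.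
    apply: le_trans A _; have := ler_norm (C k); rewrite /c in he *; nra.
  rewrite (_ : h^-1 * b - z = (h^-1 * b - h^-1 * a) + (h^-1 * a - z)); last by ring.
  have := ler_normD (h^-1 * b - h^-1 * a) (h^-1 * a - z); lra.
exists psi; split => // [t tr|k s sr].
  by have := cv 0%N t tr; have := h0 t tr => a b; exact: (cvg_unique _ b a).
apply/is_derive_epsP => e e0; have [d d0 hd] := room s sr.
pose c := `|C k| + 1; have c0 : 0 < c by rewrite /c; have := normr_ge0 (C k); lra.
exists (Num.min d (e / c)); first by rewrite lt_min d0 divr_gt0.
move=> h; rewrite lt_min => /andP[hd1]; rewrite ltr_pdivlMr // => hd2.
have shr := hd h hd1.
have L : `|g k i (s + h) - g k i s - h * g k.+1 i s| @[i --> F] -->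
    `|psi k (s + h) - psi k s - h * psi k.+1 s|.
  apply: cvg_norm; apply: cvgB; first by apply: cvgB; apply: cv.
  by apply: cvgM; [apply: cvg_cst|apply: cv].
apply: (cvgr_to_le L); have := hT k _ _ shr sr; apply: filterS => i.
rewrite (_ : s + h - s = h); last by ring.
move=> H; apply: le_trans H _; rewrite -real_normK ?num_real // expr2 mulrA.
rewrite ler_wpM2r //.
have := ler_norm (C k); have := normr_ge0 h; rewrite /c in hd2; nra.
Qed.

(** With [a = x^-1] and [b = y^-1] this is the first order Taylor bound of [x ^- m]
    at [y]. The remainder is [(x - y) ^+ 2] times a polynomial in [a], [b] with
    nonnegative coefficients, found by the recursion of the induction step. *)
Lemma inv_taylor (m : nat) : exists2 c : R, 0 <= c & forall a b : R,
  0 < a <= 2 -> 0 < b <= 2 ->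
  `|a ^+ m - b ^+ m + m%:R * (a^-1 - b^-1) * b ^+ m.+1| <= c * (a^-1 - b^-1) ^+ 2.
Proof.
elim: m => [|m [c c0 IH]].
  exists 0 => // a b _ _; by rewrite !expr0 subrr !mul0r addr0 normr0.
exists (2 * c + m.+1%:R * (2 * 2 ^+ m.+2)).
  apply: addr_ge0; first by rewrite mulr_ge0.
  by rewrite mulr_ge0 // mulr_ge0 // exprn_ge0.
move=> a b ha hb; have := IH a b ha hb.
move: ha hb => /andP[a0 a2] /andP[b0 b2].
set w := a^-1 - b^-1; set E := (X in `|X|) => hE.
have -> : a ^+ m.+1 - b ^+ m.+1 + m.+1%:R * w * b ^+ m.+2 =
    a * E + m.+1%:R * (w ^+ 2 * (a * b ^+ m.+2)).
  rewrite /E /w -natr1 !exprS; field; lra.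
apply: le_trans (ler_normD _ _) _; rewrite mulrDl lerD //.
  rewrite normrM gtr0_norm // -[2 * c * _]mulrA.
    by apply: ler_pM => //; apply: ltW.
have hab : 0 <= a * b ^+ m.+2 by rewrite mulr_ge0 ?exprn_ge0 ?ltW.
have w2 : 0 <= w ^+ 2 by rewrite sqr_ge0.
rewrite ger0_norm; last by rewrite mulr_ge0 // mulr_ge0.
rewrite -mulrA ler_wpM2l // mulrC ler_wpM2r //.
by apply: ler_pM => //; rewrite ?exprn_ge0 ?lerXn2r ?nnegrE // ltW.
Qed.
End scalar.

(** * Sums of Cauchy kernels and convex functions *)

Section kernels.
Local Open Scope classical_set_scope.
Variable R : realType.
Implicit Types (f g : R -> R) (x t c l : R).

Definition kernel_valid (K : R) (s : seq (R * R)) :=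
  forall p, p \in s -> 0 <= p.1 /\ 0 <= p.2 <= K.

(** The [k]-th derivative of [\sum_p p.1 / (1 + t * p.2)]. *)
Definition kernel_sum (k : nat) (s : seq (R * R)) t : R :=
  (-1) ^+ k * k`!%:R * \sum_(p <- s) p.1 * (p.2 ^+ k * (1 + t * p.2)^-1 ^+ k.+1).

(** For [|t| < 1 / (2 K)] the factors [1 + t * p.2] are at least [1 / 2], so the
    constant depends on [s] only through its total mass. *)
Lemma kernel_sum_taylor (K : R) (k : nat) : 0 < K -> exists c : R,
  forall s t u, kernel_valid K s -> `|t| < (2 * K)^-1 -> `|u| < (2 * K)^-1 ->
  `|kernel_sum k s t - kernel_sum k s u - (t - u) * kernel_sum k.+1 s u| <=
  c * (\sum_(p <- s) p.1) * (t - u) ^+ 2.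
Proof.
move=> K0; have [c c0 hc] := inv_taylor R k.+1.
exists (k`!%:R * (K ^+ k.+2 * c)) => s t u hs ht hu.
have bnd (z d : R) : `|z| < (2 * K)^-1 -> 0 <= d <= K ->
    0 < (1 + z * d)^-1 <= 2.
  move=> hz /andP[d0 dK].
  have hzd : `|z * d| <= 2^-1.
    rewrite normrM (ger0_norm d0) (le_trans (ler_wpM2l _ dK)) //.
    have : `|z| * (2 * K) < 1 by rewrite -ltr_pdivlMr ?mulr_gt0 // mul1r.
    by move=> h; rewrite -(ler_pM2l (ltr0Sn _ 1)) mulfV ?pnatr_eq0 //; lra.
  move: hzd; rewrite ler_norml => /andP[h1 _].
  have h2 : 2^-1 <= 1 + z * d by lra.
  rewrite invr_gt0 (lt_le_trans _ h2) ?invr_gt0 //=.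
  by rewrite -(invrK 2) lef_pV2 ?posrE ?invr_gt0 // (lt_le_trans _ h2) ?invr_gt0.
rewrite /kernel_sum.
have -> : (-1) ^+ k * k`!%:R * (\sum_(p <- s) p.1 * (p.2 ^+ k * (1 + t * p.2)^-1 ^+ k.+1)) -
  (-1) ^+ k * k`!%:R * (\sum_(p <- s) p.1 * (p.2 ^+ k * (1 + u * p.2)^-1 ^+ k.+1)) -
  (t - u) * ((-1) ^+ k.+1 * (k.+1)`!%:R *
     \sum_(p <- s) p.1 * (p.2 ^+ k.+1 * (1 + u * p.2)^-1 ^+ k.+2)) =
  \sum_(p <- s) (-1) ^+ k * k`!%:R * (p.1 * (p.2 ^+ k *
    ((1 + t * p.2)^-1 ^+ k.+1 - (1 + u * p.2)^-1 ^+ k.+1 +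
     k.+1%:R * ((1 + t * p.2)^-1^-1 - (1 + u * p.2)^-1^-1) * (1 + u * p.2)^-1 ^+ k.+2))).
  rewrite !mulr_sumr -!sumrB; apply: eq_bigr => p _.
  rewrite !invrK factS natrM !exprS; ring.
apply: le_trans (ler_norm_sum _ _ _) _.
rewrite mulr_sumr mulr_suml; rewrite big_seq [leRHS]big_seq; apply: ler_sum => p ps.
have [p1 p2] := hs p ps; have /andP[p20 p2K] := p2.
set D := (X in (-1) ^+ k * k`!%:R * (p.1 * (_ * X))); set Kk := K ^+ k.+2.
have -> : `|(-1) ^+ k * k`!%:R * (p.1 * (p.2 ^+ k * D))| =
    k`!%:R * (p.1 * (p.2 ^+ k * `|D|)).
  rewrite !normrM normrX normrN1 expr1n mul1r normr_nat (ger0_norm p1).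
  by rewrite normrX (ger0_norm p20).
have -> : k`!%:R * (Kk * c) * p.1 * (t - u) ^+ 2 =
  k`!%:R * (p.1 * (Kk * (c * (t - u) ^+ 2))) by ring.
rewrite ler_wpM2l ?ler0n // ler_wpM2l //.
have hX : `|D| <= c * ((t - u) * p.2) ^+ 2.
  have := hc _ _ (bnd t _ ht p2) (bnd u _ hu p2).
  rewrite /D !invrK (_ : 1 + t * p.2 - (1 + u * p.2) = (t - u) * p.2) //; ring.
apply: le_trans (_ : p.2 ^+ k * (c * ((t - u) * p.2) ^+ 2) <= _).
  by rewrite ler_wpM2l ?exprn_ge0.
have -> : p.2 ^+ k * (c * ((t - u) * p.2) ^+ 2) = p.2 ^+ k.+2 * (c * (t - u) ^+ 2).
  by rewrite !exprS; ring.
rewrite ler_wpM2r //; first by rewrite mulr_ge0 // sqr_ge0.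
by rewrite /Kk lerXn2r ?nnegrE // ltW.
Qed.

(** Interpolation on finite sets is enough: once [0] is among the points, the total
    mass of the interpolating sums is [phi 0], which makes their Taylor bounds
    uniform. So along the filter of finite sets of points the derivatives
    converge as well, and the signs [(-1) ^+ k] survive in the limit. *)
Lemma kernel_interpolation_deriv (K : R) (phi : R -> R) : 0 < K ->
  (forall T : seq R, (forall t, t \in T -> `|t| < (2 * K)^-1) ->
     exists2 s, kernel_valid K s & forall t, t \in T -> phi t = kernel_sum 0 s t) ->
  forall k, exists2 c, kth_deriv k phi c & 0 <= (-1) ^+ k * c.
Proof.
move=> K0 hT; set r := (2 * K)^-1 in hT *.
have r0 : 0 < r by rewrite invr_gt0 mulr_gt0.
pose B (T : seq R) : set (seq (R * R)) := [set s | kernel_valid K s /\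
  forall t, t \in 0 :: T -> `|t| < r -> phi t = kernel_sum 0 s t].
pose F := filter_from setT B.
have FF : ProperFilter F.
  apply: filter_from_proper; first apply: filter_fromT_filter.
  - by exists [::].
  - move=> S T; exists (S ++ T) => s [vs hs]; split; split=> // t tS tr;
      by apply: hs => //; move: tS; rewrite !inE mem_cat => /orP[->//|->]; rewrite ?orbT.
  - move=> T _; have [|s vs hs] := hT [seq t <- 0 :: T | `|t| < r].
      by move=> t; rewrite mem_filter => /andP[].
    by exists s; split=> // t tT tr; apply: hs; rewrite mem_filter tr.
have FB T : F (B T) by exists T.
have [c hc] := choice (fun k => kernel_sum_taylor k K0).
have [||psi [h0 hcv hd]] := @derivative_of_limit R _ F FF kernel_sum phi r
    (fun k => c k * phi 0).
- move=> k t s tr sr; apply: filterS (FB [::]) => p [vp hp].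
  have := hc k p t s vp tr sr; congr (_ <= _ * _ * _).
  rewrite (hp 0) ?inE ?normr0 // /kernel_sum expr0 mul1r mul1r.
  by apply: eq_bigr => q _; rewrite expr0 mul0r addr0 invr1 expr1n !mulr1.
- move=> t tr; apply/cvgrPdist_le => e e0.
  apply: filterS (FB [:: t]) => s [_ hs] /=.
  by rewrite -hs ?inE ?eqxx ?orbT // subrr normr0 ltW.
move=> k; exists (psi k 0).
  by exists r => //; exists psi; split=> // j t _; apply: hd.
have r00 : `|0 : R| < r by rewrite normr0.
have L : (-1) ^+ k * kernel_sum k s 0 @[s --> F] --> (-1) ^+ k * psi k 0.
  by apply: cvgM; [apply: cvg_cst|apply: hcv].
apply: (cvgr_to_ge L); apply: filterS (FB [::]) => s [vs _].
rewrite /kernel_sum !mulrA -exprD addnn -mul2n exprM sqrrN !expr1n mul1r.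
rewrite mulr_ge0 // big_seq sumr_ge0 // => p /vs[p1 /andP[p2 _]].
by rewrite mul0r addr0 invr1 expr1n mulr1 mulr_ge0 // exprn_ge0.
Qed.

Lemma derive_ge0_le01 f (df : R -> R) :
  (forall t, 0 <= t <= 1 -> is_derive t 1 f (df t)) ->
  (forall t, 0 <= t <= 1 -> 0 <= df t) -> f 0 <= f 1.
Proof.
move=> hd h0; have [t||c c01] := @MVT R f df 0 1 ltr01.
- by rewrite in_itv /= => /andP[t0 t1]; apply: hd; rewrite !ltW.
- apply: derivable_within_continuous => t; rewrite in_itv /= => t01.
  by have [] := hd t t01.
rewrite subr0 mulr1 -subr_ge0 => ->; apply: h0.
by move: c01; rewrite in_itv /= => /andP[c0 c1]; rewrite !ltW.
Qed.

(** At [y] and at its mirror image [2 * a - y] the graph lies above its tangent at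
    [a], and midpoint concavity bounds the sum of both values by [2 * f a]: so [f]
    equals its tangent on the whole interval of length [2 * a] centred at [a]. *)
Lemma convex_midconcave_affine f : smooth_on `]0, +oo[%R f ->
  (forall x, 0 < x -> 0 <= derive1n 2 f x) ->
  (forall x y, 0 < x -> 0 < y -> f x + f y <= 2 * f ((x + y) / 2)) ->
  exists a b, forall x, 0 < x -> f x = a * x + b.
Proof.
move=> sm f2 mc; set f1 := derive1n 1 f.
have pos (x : R) : 0 < x -> x \in `]0, +oo[%R by rewrite in_itv /= andbT.
have d0 (x : R) : 0 < x -> is_derive x 1 f (f1 x).
  by move=> /pos /(sm 0) /= h; rewrite /f1 derive1n1 derive1E; apply: derivableP.
have d1 (x : R) : 0 < x -> is_derive x 1 f1 (derive1n 2 f x).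
  by move=> /pos /(sm 1) h; rewrite derive1nS derive1E; apply: derivableP.
have mvt (g dg : R -> R) : (forall x, 0 < x -> is_derive x 1 g (dg x)) ->
  forall x y, 0 < x -> x < y -> exists2 z, x < z < y & g y - g x = dg z * (y - x).
  move=> hg x y x0 xy; have [z||c] := @MVT R g dg x y xy.
  - by rewrite in_itv /= => /andP[xz _]; apply: hg; lra.
  - apply: derivable_within_continuous => z; rewrite in_itv /= => /andP[xz _].
    by have [] := hg z ltac:(lra).
  - by rewrite in_itv /=; exists c.
have f1mono x y : 0 < x -> x <= y -> f1 x <= f1 y.
  move=> x0; rewrite le_eqVlt => /predU1P[->//|xy].
  have [z /andP[xz zy] h] := mvt _ _ d1 x y x0 xy.
  by have := f2 z ltac:(lra); nra.
have tg x y : 0 < x -> 0 < y -> f x + f1 x * (y - x) <= f y.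
  move=> x0 y0; case: (ltgtP x y) => [xy|yx|->]; last by lra.
  - have [z /andP[xz zy] h] := mvt _ _ d0 x y x0 xy.
    by have := f1mono x z x0 ltac:(lra); nra.
  - have [z /andP[yz zx] h] := mvt _ _ d0 y x y0 yx.
    by have := f1mono z x ltac:(lra) ltac:(lra); nra.
have loc a y : 0 < a -> 0 < y -> y < 2 * a -> f y = f a + f1 a * (y - a).
  move=> a0 y0 ya; have := tg a y a0 y0; have := tg a (2 * a - y) a0 ltac:(lra).
  have := mc y (2 * a - y) y0 ltac:(lra).
  rewrite (_ : (y + (2 * a - y)) / 2 = a); last by field.
  by move=> h1 h2 h3; apply/eqP; rewrite eq_le; apply/andP; split; lra.
(* The coefficients are read off at [1 / 2] and [1]; both points and [x] lie in the
   interval centred at [1 + x]. *)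
exists (2 * (f 1 - f (1 / 2))), (f 1 - 2 * (f 1 - f (1 / 2))) => x x0.
have h := loc (1 + x).
have h1 := h 1 ltac:(lra) ltac:(lra) ltac:(lra).
have h2 := h (1 / 2) ltac:(lra) ltac:(lra) ltac:(lra).
have h3 := h x ltac:(lra) x0 ltac:(lra).
rewrite h1 h2 h3; lra.
Qed.
End kernels.

(** * Quadratic forms and diagonal decompositions *)

Section matrices.
Variables (R : realType) (cc : complex_model R).
Local Notation C := (cplx cc).
Local Notation "x %:C" := (@creal R cc x) : ring_scope.
Implicit Types (x y : R).

Definition qf n (u : 'rV[C]_n) (M : 'M[C]_n) : R :=
  cre ((u *m M *m u^t*) 0 0).

Definition nsq (z : C) : R := cre (z * z^*).

Definition rdiag n (d : 'rV[R]_n) : 'M[C]_n := diag_mx (map_mx creal d).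

Definition udiag m n (T : 'M[C]_(m, n)) (d : 'rV[R]_m) : 'M[C]_n :=
  T^t* *m rdiag d *m T.

Lemma adjM m n p (A : 'M[C]_(m, n)) (B : 'M[C]_(n, p)) :
  (A *m B)^t* = B^t* *m A^t*.
Proof. by rewrite trmx_mul map_mxM. Qed.

Lemma adjZ m n (a : C) (A : 'M[C]_(m, n)) : (a *: A)^t* = (a^*)%R *: A^t*.
Proof. by apply/matrixP=> i j; rewrite !mxE rmorphM. Qed.

Lemma adjD m n (A B : 'M[C]_(m, n)) : (A + B)^t* = A^t* + B^t*.
Proof. by apply/matrixP=> i j; rewrite !mxE rmorphD. Qed.

Lemma adj_rdiag n (d : 'rV[R]_n) : (rdiag d)^t* = rdiag d.
Proof.
apply/matrixP=> i j; rewrite !mxE eq_sym.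
by case: eqVneq => [->|_]; rewrite ?mulr1n ?mulr0n ?rmorph0 ?conj_creal.
Qed.

Lemma adj_udiag m n (T : 'M[C]_(m, n)) d : (udiag T d)^t* = udiag T d.
Proof. by rewrite /udiag !adjM trmxCK adj_rdiag mulmxA. Qed.

Lemma herm_udiag m n (T : 'M[C]_(m, n)) d : cherm (udiag T d).
Proof. exact: adj_udiag. Qed.

Lemma mulJ_nsq z : z * z^* = (nsq z)%:C.
Proof. by rewrite /nsq real_cre // ger0_real // mul_conjC_ge0. Qed.

Lemma nsq_ge0 z : 0 <= nsq z.
Proof. by rewrite cre_ge0 // mul_conjC_ge0. Qed.

Lemma nsq_eq0 z : (nsq z == 0) = (z == 0).
Proof.
by rewrite -(inj_eq (@creal_inj R cc)) -mulJ_nsq rmorph0 mul_conjC_eq0.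
Qed.

Lemma nsqM x z : nsq (x%:C * z) = x ^+ 2 * nsq z.
Proof.
apply: (@creal_inj R cc); rewrite [RHS]rmorphM rmorphXn -!mulJ_nsq [(_ * z)^*]rmorphM /= conj_creal; ring.
Qed.

Lemma nsq_real x : nsq x%:C = x ^+ 2.
Proof. by rewrite /nsq conj_creal -rmorphM crealK. Qed.

Lemma nsq1 : nsq 1 = 1.
Proof. by have := nsq_real 1; rewrite rmorph1 expr1n. Qed.

Lemma nsq0 : nsq 0 = 0.
Proof. by have := nsq_real 0; rewrite rmorph0 expr0n. Qed.

Lemma qfD n u (A B : 'M[C]_n) : qf u (A + B) = qf u A + qf u B.
Proof. by rewrite /qf mulmxDr mulmxDl mxE raddfD. Qed.

Lemma qfZ n u a (A : 'M[C]_n) : qf u (a%:C *: A) = a * qf u A.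
Proof.
by rewrite /qf -scalemxAr -scalemxAl mxE creM.
Qed.

Lemma qfN n u (A : 'M[C]_n) : qf u (- A) = - qf u A.
Proof. by rewrite /qf mulmxN mulNmx mxE raddfN. Qed.

Lemma qfB n u (A B : 'M[C]_n) : qf u (A - B) = qf u A - qf u B.
Proof. by rewrite qfD qfN. Qed.

Lemma qf_conj m n (u : 'rV[C]_n) (T : 'M[C]_(n, m)) (A : 'M[C]_m) :
  qf u (T *m A *m T^t*) = qf (u *m T) A.
Proof. by rewrite /qf adjM !mulmxA. Qed.

Lemma mul_rdiag m n (A : 'M[C]_(m, n)) d i j : (A *m rdiag d) i j = A i j * (d 0 j)%:C.
Proof.
rewrite mxE (bigD1 j) //= big1 ?addr0; first by rewrite !mxE eqxx mulr1n.
by move=> k kj; rewrite !mxE (negPf kj) mulr0n mulr0.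
Qed.

Lemma rdiag_mul m n (A : 'M[C]_(m, n)) d i j : (rdiag d *m A) i j = (d 0 i)%:C * A i j.
Proof. by rewrite mul_diag_mx !mxE. Qed.

Lemma rdiagM n (d e : 'rV[R]_n) : rdiag d *m rdiag e = rdiag (\row_i (d 0 i * e 0 i)).
Proof.
apply/matrixP=> i j; rewrite mul_rdiag !mxE.
case: eqVneq => [->|_]; rewrite ?mulr1n ?mulr0n ?mul0r //.
by rewrite -rmorphM.
Qed.

Lemma rdiag_const n (c : R) : rdiag (const_mx c : 'rV_n) = c%:C%:M.
Proof. by apply/matrixP=> i j; rewrite !mxE; case: eqP. Qed.

Lemma qf_rdiag n (u : 'rV[C]_n) d : qf u (rdiag d) = \sum_i nsq (u 0 i) * d 0 i.
Proof.
rewrite /qf mxE raddf_sum /=; apply: eq_bigr => i _.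
by rewrite mul_rdiag !mxE mulrAC mulJ_nsq -rmorphM crealK.
Qed.

Lemma qf_udiag m n (T : 'M[C]_(m, n)) d (u : 'rV[C]_n) :
  qf u (udiag T d) = \sum_i nsq ((u *m T^t*) 0 i) * d 0 i.
Proof. by rewrite /udiag -{2}(trmxCK T) qf_conj qf_rdiag. Qed.

Definition sqnorm n (u : 'rV[C]_n) : R := \sum_i nsq (u 0 i).

Lemma qf_scalar n (u : 'rV[C]_n) c : qf u c%:C%:M = c * sqnorm u.
Proof.
rewrite -rdiag_const qf_rdiag /sqnorm mulr_sumr; apply: eq_bigr => i _.
by rewrite mxE mulrC.
Qed.

Lemma qf1 n (u : 'rV[C]_n) : qf u 1%:M = sqnorm u.
Proof. by have := qf_scalar u 1; rewrite rmorph1 mul1r. Qed.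

Lemma sqnorm_ge0 n (u : 'rV[C]_n) : 0 <= sqnorm u.
Proof. by apply: sumr_ge0 => i _; apply: nsq_ge0. Qed.

Lemma sqnorm_gt0 n (u : 'rV[C]_n) : (0 < sqnorm u) = (u != 0).
Proof.
rewrite lt_def sqnorm_ge0 andbT; congr (~~ _); apply/eqP/eqP => [h|->].
  apply/rowP => i; rewrite mxE; apply/eqP; rewrite -nsq_eq0; apply/eqP.
  by move: h => /psumr_eq0P -> // j _; apply: nsq_ge0.
by rewrite /sqnorm big1 // => i _; rewrite mxE; apply/eqP; rewrite nsq_eq0.
Qed.

Lemma unitary_mul1 n (Q : 'M[C]_n) : Q \is unitarymx -> Q^t* *m Q = 1%:M.
Proof. by move=> h; rewrite -invmx_unitary // mulVmx // unitarymx_unit. Qed.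

Lemma sqnorm_unitary n (Q : 'M[C]_n) (u : 'rV[C]_n) :
  Q \is unitarymx -> sqnorm (u *m Q^t*) = sqnorm u.
Proof.
by move=> h; rewrite -!qf1 -qf_conj mulmx1 trmxCK unitary_mul1.
Qed.

Lemma udiagM n (Q : 'M[C]_n) d e : Q \is unitarymx ->
  udiag Q d *m udiag Q e = udiag Q (\row_i (d 0 i * e 0 i)).
Proof.
by move=> /unitarymxP h; rewrite /udiag -rdiagM -!mulmxA (mulmxA Q) h mul1mx.

Qed.

Lemma udiagD m n (T : 'M[C]_(m, n)) d e : udiag T d + udiag T e = udiag T (d + e).
Proof.
by rewrite /udiag -mulmxDl -mulmxDr /rdiag -raddfD /= -map_mxD.
Qed.

Lemma udiag_const n (Q : 'M[C]_n) c : Q \is unitarymx ->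
  udiag Q (const_mx c) = c%:C%:M.
Proof.
move=> h; rewrite /udiag rdiag_const mul_mx_scalar -scalemxAl unitary_mul1 //.
by rewrite scalemx1.
Qed.
End matrices.
Arguments rdiag {R cc n}.

(** * Functional calculus of Hermitian matrices *)

Section calculus.
Variables (R : realType) (cc : complex_model R).
Local Notation C := (cplx cc).
Local Notation "x %:C" := (@creal R cc x) : ring_scope.
Implicit Types (x y : R).

Lemma spectral_decomp n (A : 'M[C]_n) : cherm A ->
  exists Q : 'M[C]_n, exists d : 'rV[R]_n, [/\ Q \is unitarymx, A = udiag Q d &
    forall f, cmxfun f A = udiag Q (map_mx f d)].
Proof.
move=> hA; have hQ := spectral_unitarymx A.
have /orthomx_spectralP hE := hermitian_normalmx ((chermE A).1 hA).
have hr := hermitian_spectral_diag_real ((chermE A).1 hA).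
have hm f : cmxfun f A = invmx (spectralmx A) *m
  diag_mx (map_mx (fun z => creal (f (cre z))) (spectral_diag A)) *m
  spectralmx A by exact: erefl.
move: (spectralmx A) (spectral_diag A) hQ hE hr hm => Q d hQ hE hr hm.
have Qi := invmx_unitary hQ; rewrite {}Qi in hE hm.
exists Q, (map_mx cre d); split; first exact: hQ.
  rewrite hE /udiag /rdiag -map_mx_comp (_ : map_mx _ d = d); first exact: erefl.
  by apply/rowP => i; rewrite mxE /= real_cre //; have /mxOverP := hr.
by move=> f; rewrite hm /udiag /rdiag -!map_mx_comp; exact: erefl.
Qed.

(** In eigenbases the relation says that [T] has nonzero entries only between
    equal eigenvalues, and this survives the application of [f]. *)
Lemma udiag_intertwine m n (P : 'M[C]_m) (Q : 'M[C]_n) (T : 'M[C]_(m, n)) d e f :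
  P \is unitarymx -> Q \is unitarymx ->
  T *m udiag Q d = udiag P e *m T ->
  T *m udiag Q (map_mx f d) = udiag P (map_mx f e) *m T.
Proof.
move=> hP hQ; have PP := unitarymxP hP; have QQ := unitarymxP hQ.
have PP' := unitary_mul1 hP; have QQ' := unitary_mul1 hQ.
pose W := P *m T *m Q^t*.
have E g h : T *m udiag Q g = udiag P h *m T <-> W *m rdiag g = rdiag h *m W.
  split=> [H|H].
    have := congr1 (fun X => P *m X *m Q^t*) H; rewrite /udiag -!mulmxA QQ mulmx1.
    by rewrite (mulmxA P (P^t* )) PP mul1mx /W -!mulmxA.
  have := congr1 (fun X => P^t* *m X *m Q) H; rewrite /W /udiag -!mulmxA QQ' mulmx1.
  by rewrite (mulmxA (P^t* ) P) PP' mul1mx.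
move=> /E H; apply/E; clearbody W; apply/matrixP=> i j.
have /matrixP /(_ i j) := H; rewrite !mul_rdiag !rdiag_mul !mxE.
rewrite (mulrC _ (W i j)) (mulrC _ (W i j)).
have [-> _|w0 /(mulfI w0)/creal_inj ->] := eqVneq (W i j) 0.
  by rewrite !mul0r.
by [].
Qed.

(** Two diagonalizations of one matrix are intertwined by the identity, so the
    functional calculus does not depend on the choice made in [spectralmx]. *)
Lemma mxfun_udiag n (Q : 'M[C]_n) d f : Q \is unitarymx ->
  cmxfun f (udiag Q d) = udiag Q (map_mx f d).
Proof.
move=> hQ; have [P [e [hP hA hf]]] := spectral_decomp (herm_udiag Q d).
have one (X Y : 'M[C]_n) : 1%:M *m X = Y *m 1%:M <-> X = Y.
  by rewrite mul1mx mulmx1.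
by rewrite hf; have /one <- := udiag_intertwine f hP hQ ((one _ _).2 hA).
Qed.

Lemma mxfun_intertwine m n (A : 'M[C]_n) (B : 'M[C]_m) (T : 'M[C]_(m, n)) f :
  cherm A -> cherm B -> T *m A = B *m T ->
  T *m cmxfun f A = cmxfun f B *m T.
Proof.
move=> /spectral_decomp [Q [d [hQ -> ->]]] /spectral_decomp [P [e [hP -> ->]]].
exact: udiag_intertwine.
Qed.

Lemma unitary1 n : (1%:M : 'M[C]_n) \is unitarymx.
Proof. by apply/unitarymxP; rewrite trmx1 map_mx1 mulmx1. Qed.

Lemma udiag1 n (d : 'rV[R]_n) : udiag (1%:M : 'M[C]_n) d = rdiag d.
Proof. by rewrite /udiag trmx1 map_mx1 mul1mx mulmx1. Qed.

Lemma mxfun_rdiag n (d : 'rV[R]_n) f : cmxfun f (rdiag d : 'M[C]_n) = rdiag (map_mx f d).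
Proof. by rewrite -!udiag1 mxfun_udiag ?unitary1. Qed.

Lemma herm_mxfun n (A : 'M[C]_n) f : cherm A -> cherm (cmxfun f A).
Proof. by move=> /spectral_decomp [Q [d [hQ _ ->]]]; apply: herm_udiag. Qed.

Lemma mxfunD n (A : 'M[C]_n) f g : cherm A ->
  cmxfun (fun x => f x + g x) A = cmxfun f A + cmxfun g A.
Proof.
move=> /spectral_decomp [Q [d [hQ _ h]]]; rewrite !h udiagD.
by congr udiag; apply/rowP => i; rewrite !mxE.
Qed.

Lemma mxfunM n (A : 'M[C]_n) f g : cherm A ->
  cmxfun (fun x => f x * g x) A = cmxfun f A *m cmxfun g A.
Proof.
move=> /spectral_decomp [Q [d [hQ _ h]]]; rewrite !h (udiagM _ _ hQ).
by congr udiag; apply/rowP => i; rewrite !mxE.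
Qed.

Lemma mxfun_id n (A : 'M[C]_n) : cherm A -> cmxfun id A = A.
Proof. by move=> /spectral_decomp [Q [d [hQ hA h]]]; rewrite h map_mx_id. Qed.

Lemma mxfun_cst n (A : 'M[C]_n) c : cherm A -> cmxfun (fun=> c) A = c%:C%:M.
Proof.
move=> /spectral_decomp [Q [d [hQ hA h]]]; rewrite h -(udiag_const c hQ).
by congr udiag; apply/rowP => i; rewrite !mxE.
Qed.

Lemma eigenvalue_udiag n (Q : 'M[C]_n) d (a : C) : Q \is unitarymx ->
  eigenvalue (udiag Q d) a <-> exists i, a = (d 0 i)%:C.
Proof.
move=> hQ; have QQ := unitarymxP hQ; have QQ' := unitary_mul1 hQ.
split=> [/eigenvalueP [v hv v0]|[i ->]].
  have : v *m Q^t* != 0.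
    apply: contra_neq v0 => h.
    by rewrite -(mulmx1 v) -QQ' mulmxA h mul0mx.
  move=> /rV0Pn [i hi]; exists i.
  have := congr1 (fun X => X *m Q^t*) hv.
  rewrite /udiag -!mulmxA QQ mulmx1 mulmxA => /rowP /(_ i).
  rewrite mul_rdiag -scalemxAl [RHS]mxE [RHS]mulrC => /(mulfI hi) <-.
  exact: erefl.
apply/eigenvalueP; exists (row i Q).
  rewrite /udiag !mulmxA -row_mul QQ -row_mul mul1mx.
  apply/rowP=> k; rewrite mxE (bigD1 i) //= !mxE eqxx mulr1n big1 ?addr0 //.
  by move=> j ji; rewrite !mxE eq_sym (negPf ji) mulr0n mul0r.
apply/eqP => /(congr1 (fun X => X *m Q^t*)); rewrite -row_mul QQ mul0mx.
by move=> /rowP /(_ i) /eqP; rewrite !mxE eqxx oner_eq0.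
Qed.

Lemma spec_inP (I : interval R) n (A : 'M[C]_n) : cspec I A ->
  exists Q : 'M[C]_n, exists d : 'rV[R]_n, [/\ Q \is unitarymx, A = udiag Q d,
    forall f, cmxfun f A = udiag Q (map_mx f d) & forall i, d 0 i \in I].
Proof.
move=> [hA hI]; have [Q [d [hQ AE fE]]] := spectral_decomp hA.
exists Q, d; split=> // i.
have [|x xI /creal_inj ->//] := hI (d 0 i)%:C.
by rewrite AE eigenvalue_udiag //; exists i.
Qed.

Lemma spec_in_udiag (I : interval R) n (Q : 'M[C]_n) (d : 'rV_n) : Q \is unitarymx ->
  (forall i, d 0 i \in I) -> cspec I (udiag Q d).
Proof.
move=> hQ hI; split=> [|a]; first exact: herm_udiag.
by rewrite eigenvalue_udiag // => -[i ->]; exists (d 0 i).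
Qed.

Lemma udiag_qf_row n (Q : 'M[C]_n) (d : 'rV_n) i : Q \is unitarymx ->
  qf (row i Q) (udiag Q d) = d 0 i.
Proof.
move=> hQ; rewrite qf_udiag -row_mul (unitarymxP hQ) (bigD1 i) //= !mxE eqxx.
rewrite big1 ?addr0 => [|j ji]; first by rewrite nsq1 mul1r.
by rewrite !mxE eq_sym (negPf ji) nsq0 mul0r.
Qed.

Lemma spec_posP n (A : 'M[C]_n) : cspec `]0, +oo[ A <->
  cherm A /\ forall u, u != 0 -> 0 < qf u A.
Proof.
split=> [/spec_inP [Q [d [hQ -> _ hd]]]|[hA hu]].
  split=> [|u u0]; first exact: herm_udiag.
  have : u *m Q^t* != 0.
    apply: contra_neq u0 => h.
    by rewrite -(mulmx1 u) -(unitary_mul1 hQ) mulmxA h mul0mx.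
  move=> /rV0Pn [i hi]; rewrite qf_udiag (bigD1 i) //=.
  have pos j : 0 < d 0 j by have := hd j; rewrite in_itv /= andbT.
  apply: ltr_wpDr; first by apply: sumr_ge0 => j _; rewrite mulr_ge0 ?nsq_ge0 ?ltW.
  by rewrite mulr_gt0 // lt_def nsq_ge0 nsq_eq0 hi.
have [Q [d [hQ AE _]]] := spectral_decomp hA.
rewrite AE; apply: spec_in_udiag => // i; rewrite in_itv /= andbT.
rewrite -(udiag_qf_row d i hQ) -AE; apply: hu.
apply/eqP => h; have := udiag_qf_row (const_mx 1) i hQ.
by rewrite h /qf !mul0mx mxE raddf0 mxE => /esym/eqP; rewrite oner_eq0.
Qed.

Lemma qf_real n (A : 'M[C]_n) u : cherm A -> (qf u A)%:C = (u *m A *m u^t*) 0 0.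
Proof.
rewrite /cherm => hA; apply: real_cre; apply/CrealP.
have h : (u *m A *m u^t*)^t* = u *m A *m u^t*.
  by rewrite !adjM trmxCK hA mulmxA.
by have := congr1 (fun X : 'M[C]_1 => X 0 0) h; rewrite mxE mxE.
Qed.

Lemma psdP n (A : 'M[C]_n) : cpsd A <-> cherm A /\ forall u, 0 <= qf u A.
Proof.
by split=> -[hA hu]; split=> // u; have := hu u; rewrite -(qf_real u hA) creal_ge0.
Qed.

Lemma qf_mxfun_bound n (A : 'M[C]_n) (u : 'rV[C]_n) g c : cherm A ->
  (forall x : R, eigenvalue A x%:C -> `|g x| <= c) ->
  `|qf u (cmxfun g A)| <= c * sqnorm u.
Proof.
move=> hA; have [Q [d [hQ AE ->]]] := spectral_decomp hA; rewrite AE => hg.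
rewrite -(sqnorm_unitary u hQ) qf_udiag (le_trans (ler_norm_sum _ _ _)) //.
rewrite /sqnorm mulr_sumr; apply: ler_sum => i _.
rewrite normrM ger0_norm ?nsq_ge0 // mulrC ler_wpM2r ?nsq_ge0 // mxE; apply: hg.
by apply/eigenvalue_udiag => //; exists i.
Qed.

Lemma mxfun_ext n (A : 'M[C]_n) f g : cherm A ->
  (forall x : R, eigenvalue A x%:C -> f x = g x) -> cmxfun f A = cmxfun g A.
Proof.
move=> hA; have [Q [d [hQ AE hf]]] := spectral_decomp hA.
rewrite !hf AE => h; congr udiag; apply/rowP => i; rewrite !mxE h //.
by apply/eigenvalue_udiag => //; exists i.
Qed.

End calculus.

(** * Polarization and Hermite interpolation *)

Section polarization.
Variables (R : realType) (cc : complex_model R).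
Local Notation C := (cplx cc).
Local Notation "x %:C" := (@creal R cc x) : ring_scope.

Lemma qf_sum n (u : 'rV[C]_n) (M : 'M[C]_n) :
  qf u M = \sum_i \sum_j cre (u 0 i * (u 0 j)^* * M i j).
Proof.
rewrite /qf mxE raddf_sum /= exchange_big /=; apply: eq_bigr => j _.
rewrite !mxE mulr_suml raddf_sum /=; apply: eq_bigr => i _.
by congr (cre _); ring.
Qed.

Lemma qf_add n (u v : 'rV[C]_n) (M : 'M[C]_n) : cherm M ->
  qf (u + v) M = qf u M + qf v M + 2 * cre ((u *m M *m v^t*) 0 0).
Proof.
move=> hM; have h : (u *m M *m v^t*)^t* = v *m M *m u^t*.
  by rewrite !adjM trmxCK hM mulmxA.
have := congr1 (fun X : 'M[C]_1 => cre (X 0 0)) h; rewrite mxE mxE cre_conj => h'.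
have cD (X Y : 'M[C]_1) : cre ((X + Y) 0 0) = cre (X 0 0) + cre (Y 0 0).
  by rewrite mxE raddfD.
rewrite /qf adjD mulmxDl mulmxDr !mulmxDl !cD -h'.
move: (cre ((u *m M *m u^t*) 0 0)) (cre ((v *m M *m v^t*) 0 0)) => a b.
by move: (cre ((u *m M *m v^t*) 0 0)) => c; ring.
Qed.

Lemma delta_form n (M : 'M[C]_n) i j a : 
  ((delta_mx 0 i : 'rV[C]_n) *m M *m (a *: delta_mx 0 j : 'rV[C]_n)^t*) 0 0 =
  a^* * M i j.
Proof.
rewrite adjZ -scalemxAr mxE -rowE; congr (_ * _).
rewrite mxE (bigD1 j) //= !mxE !eqxx rmorph1 mulr1 big1 ?addr0 // => k kj.
by rewrite !mxE (negPf kj) andbF rmorph0 mulr0.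
Qed.

Lemma cre_entry n (M : 'M[C]_n) i j : cherm M ->
  cre (M i j) = 2^-1 * (qf (delta_mx 0 i + delta_mx 0 j) M
                + (- 1) * (qf (delta_mx 0 i) M + qf (delta_mx 0 j) M)).
Proof.
move=> hM; rewrite (qf_add _ _ hM) -[X in (_ *m X^t* ) 0 0]scale1r delta_form.
rewrite rmorph1 mul1r.
move: (qf (delta_mx 0 i) M) (qf (delta_mx 0 j) M) (cre (M i j)) => a b c.
by field.
Qed.

Lemma cim_entry n (M : 'M[C]_n) i j : cherm M ->
  cim (M i j) = 2^-1 * (qf (delta_mx 0 i + cpair 0 1 *: delta_mx 0 j) M
     + (- 1) * (qf (delta_mx 0 i) M + qf (cpair 0 1 *: delta_mx 0 j) M)).
Proof.
move=> hM; rewrite (qf_add _ _ hM) delta_form creMc cre_conj cim_conj.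
rewrite cre_cpair cim_cpair.
move: (qf (delta_mx 0 i) M) (qf (_ *: delta_mx 0 j) M) => a b.
by move: (cre (M i j)) (cim (M i j)) => c d; field.
Qed.

(** By polarization the quadratic forms of a Hermitian curve determine its
    entries, hence also the entrywise derivatives. *)
Lemma qf_mxderive1n n k (F : R -> 'M[C]_n) (c : 'rV[C]_n -> R) :
  (forall t, cherm (F t)) -> (forall u, kth_deriv k (fun t => qf u (F t)) (c u)) ->
  cherm (cmxderive1n k F 0) /\ forall u, qf u (cmxderive1n k F 0) = c u.
Proof.
move=> hF hc; set D := cmxderive1n k F 0.
have Dre i j : kth_deriv k (fun t => cre (F t i j)) (cre (D i j)).
  rewrite cre_mxderive1n.
  have [d hd] : exists d, kth_deriv k (fun t => cre (F t i j)) d.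
    eexists; apply: (@kth_deriv_ext _ _ _ _ _ 1 ltr01 (fun t _ => esym (cre_entry i j (hF t)))).
    by apply: kth_derivZ; apply: kth_derivD; [|apply: kth_derivZ; apply: kth_derivD].
  by rewrite (kth_derivE hd).
have Dim i j : kth_deriv k (fun t => cim (F t i j)) (cim (D i j)).
  rewrite cim_mxderive1n.
  have [d hd] : exists d, kth_deriv k (fun t => cim (F t i j)) d.
    eexists; apply: (@kth_deriv_ext _ _ _ _ _ 1 ltr01 (fun t _ => esym (cim_entry i j (hF t)))).
    by apply: kth_derivZ; apply: kth_derivD; [|apply: kth_derivZ; apply: kth_derivD].
  by rewrite (kth_derivE hd).
have sym t i j : F t j i = (F t i j)^*.
  by have /matrixP /(_ j i) := hF t; rewrite !mxE => ->.
have Dsym i j : D j i = (D i j)^*.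
  apply: cplx_eqP.
    rewrite cre_conj -(kth_derivE (Dre j i)) -(kth_derivE (Dre i j)).
      by congr (derive1n k _ 0); apply/funext => t; rewrite (sym t i j) cre_conj.
  rewrite cim_conj -(kth_derivE (Dim j i)); apply: kth_derivE; rewrite -mulN1r.
  apply: (@kth_deriv_ext _ _ (fun t => (-1) * cim (F t i j)) _ _ 1 ltr01) => [t _|].
    by rewrite (sym t i j) cim_conj mulN1r.
  by apply: kth_derivZ; apply: Dim.
clearbody D; split; first by apply/matrixP => i j; rewrite !mxE Dsym conjCK.
move=> u; rewrite -(kth_derivE (hc u)); apply/esym/kth_derivE.
apply: (@kth_deriv_ext _ _ (fun t => \sum_i \sum_j
  (cre (u 0 i * (u 0 j)^* ) * cre (F t i j) +
   (- cim (u 0 i * (u 0 j)^* )) * cim (F t i j))) _ _ 1 ltr01) => [t _|].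
  rewrite qf_sum; apply: eq_bigr => i _; apply: eq_bigr => j _.
  by rewrite [RHS]creMc mulNr.
rewrite qf_sum; apply: kth_deriv_sum => i; apply: kth_deriv_sum => j.
by rewrite [X in kth_deriv _ _ X]creMc -mulNr; apply: kth_derivD; apply: kth_derivZ.
Qed.
End polarization.

Section hermite.
Variable R : realType.

Lemma hermite_interpolation (s : seq R) (f g : R -> R) :
  exists p : {poly R}, forall x, x \in s -> p.[x] = f x /\ p^`().[x] = g x.
Proof.
elim: s => [|a s [p hp]]; first by exists 0.
have [as_|nas] := boolP (a \in s).
  by exists p => x; rewrite inE => /predU1P[->|]; apply: hp.
(* [w] vanishes to second order at the earlier nodes, so its multiples are free to
   adjust the value and the slope at [a]. *)
pose w := (\prod_(b <- s) ('X - b%:P)) ^+ 2.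
have w0 b : b \in s -> w.[b] = 0 /\ w^`().[b] = 0.
  move=> bs; have h : (\prod_(b <- s) ('X - b%:P)).[b] = 0.
    by apply/rootP; rewrite root_prod_XsubC.
  by rewrite /w expr2 derivM !hornerE h !(mulr0, mul0r, addr0).
have wa : w.[a] != 0.
  by rewrite /w horner_exp expf_neq0 // -/(root _ a) root_prod_XsubC.
pose c := (f a - p.[a]) / w.[a].
pose d := (g a - p^`().[a] - c * w^`().[a]) / w.[a].
exists (p + (c%:P + d *: ('X - a%:P)) * w) => x.
have E : (p + (c%:P + d *: ('X - a%:P)) * w).[x] = p.[x] + (c + d * (x - a)) * w.[x].
  by rewrite !hornerE.
have E' : (p + (c%:P + d *: ('X - a%:P)) * w)^`().[x] =
    p^`().[x] + (d * w.[x] + (c + d * (x - a)) * w^`().[x]).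
  by rewrite derivD derivM derivD derivZ derivC derivXsubC !hornerE.
rewrite inE E E' => /predU1P[->|xs].
  by rewrite subrr mulr0 addr0; split; rewrite /d /c; field.
by have [-> ->] := hp x xs; have [-> ->] := w0 x xs; rewrite !mulr0 !addr0.
Qed.

Lemma common_radius (s : seq R) (P : R -> R -> Prop) :
  (forall a d e, e <= d -> P a d -> P a e) ->
  (forall a, a \in s -> exists2 d, 0 < d & P a d) ->
  exists2 d, 0 < d & forall a, a \in s -> P a d.
Proof.
move=> mono; elim: s => [_|a s IH hs]; first by exists 1.
have [|d d0 hd] := IH; first by move=> b bs; apply: hs; rewrite inE bs orbT.
have [e e0 he] := hs a (mem_head _ _).
exists (Num.min d e); first by rewrite lt_min d0.
move=> b; rewrite inE => /predU1P[->|bs].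
  by apply: mono he; rewrite ge_min lexx orbT.
by apply: mono (hd b bs); rewrite ge_min lexx.
Qed.
End hermite.

(** * Differentiability of matrix functions *)

Section derivative.
Variables (R : realType) (cc : complex_model R).
Local Notation C := (cplx cc).
Local Notation "x %:C" := (@creal R cc x) : ring_scope.

Lemma cherm_line n (A X : 'M[C]_n) t : cherm A -> cherm X -> cherm (A + t%:C *: X).
Proof. by rewrite /cherm adjD adjZ conj_creal => -> ->. Qed.

(** Multiplying [p] by ['X] multiplies the curve by [A + t X], which acts on the
    coefficients by [G m A + G m.-1 X]. For diagonal [A] the coefficient of [t] then
    obeys the recursion of the first divided differences of [p]. *)
Lemma poly_curve n (A X : 'M[C]_n) (p : {poly R}) : cherm A -> cherm X ->
  exists (N : nat) (G : nat -> 'M[C]_n),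
  [/\ forall m, (N <= m)%N -> G m = 0,
      forall t, cmxfun (horner p) (A + t%:C *: X) = \sum_(m < N) (t ^+ m)%:C *: G m &
      forall d : 'rV[R]_n, A = rdiag d -> G 0%N = rdiag (map_mx (horner p) d) /\
       forall i j,
       (d 0 i - d 0 j)%:C * G 1%N i j = (p.[d 0 i] - p.[d 0 j])%:C * X i j /\
       (d 0 i = d 0 j -> G 1%N i j = (p^`().[d 0 i])%:C * X i j)].
Proof.
move=> hA hX; elim/poly_ind: p => [|p c [N [G [G0 GE Gd]]]].
  exists 0%N, (fun=> 0); split=> // [t|d _].
    rewrite big_ord0 (_ : horner 0 = fun=> 0); last by apply/funext => x; rewrite horner0.
    by rewrite (mxfun_cst _ (cherm_line t hA hX)) rmorph0 raddf0.
  split=> [|i j].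
    by apply/matrixP => i j; rewrite !mxE horner0 rmorph0 mul0rn.
  by rewrite !horner0 deriv0 horner0 subrr !mxE !rmorph0 mul0r mulr0.
exists N.+1, (fun m => G m *m A + (if m is m'.+1 then G m' *m X else c%:C%:M)).
split=> [[//|m] Nm|t|d Ad].
- by rewrite !G0 // ?mul0mx ?addr0 // ltnW.
- have hB := cherm_line t hA hX.
  rewrite (_ : horner _ = fun x => p.[x] * x + c); last by apply/funext => x; rewrite !hornerE.
  rewrite mxfunD // mxfunM // mxfun_id // mxfun_cst // GE mulmxDr.
  rewrite [in RHS](eq_bigr (fun m : 'I_N.+1 => (t ^+ m)%:C *: (G m *m A) + (t ^+ m)%:C *:
     (if (m : nat) is m'.+1 then G m' *m X else c%:C%:M))); last first.
    by move=> m _; rewrite scalerDr.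
  rewrite big_split /= big_ord_recr /= G0 // mul0mx scaler0 addr0 big_ord_recl /=.
  rewrite expr0 rmorph1 scale1r -addrA; congr (_ + _).
    by rewrite mulmx_suml; apply: eq_bigr => m _; rewrite scalemxAl.
  rewrite addrC; congr (_ + _).
  rewrite -scalemxAr mulmx_suml scaler_sumr; apply: eq_bigr => m _.
  by rewrite -scalemxAl scalerA -rmorphM -exprS.
- have [Gd0 Gd1] := Gd d Ad; split=> [|i j].
    apply/matrixP => i j; rewrite Ad Gd0 mxE mul_rdiag !mxE !hornerE.
    rewrite mulrnAl -rmorphM; case: eqP => [->|]; rewrite ?mulr1n ?mulr0n ?addr0 //.
    by rewrite -rmorphD.
  have [h1 h2] := Gd1 i j.
  rewrite mxE Ad mul_rdiag Gd0 rdiag_mul mxE !hornerE; split=> [|dij].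
    rewrite mulrDr mulrA h1 !rmorphB !rmorphD !rmorphM; ring.
  rewrite (h2 dij) -dij derivD derivM derivX derivC !hornerE rmorphD rmorphM; ring.
Qed.

Lemma qf_sum_mx n (u : 'rV[C]_n) N (G : 'I_N -> 'M[C]_n) :
  qf u (\sum_m G m) = \sum_m qf u (G m).
Proof.
elim/big_rec2: _ => [|i x y _ <-]; last by rewrite qfD.
by rewrite /qf mulmx0 mul0mx mxE raddf0.
Qed.

Lemma poly_curve_deriv n (A X : 'M[C]_n) (p : {poly R}) : cherm A -> cherm X ->
  exists D : 'M[C]_n,
    (forall u : 'rV[C]_n, is_derive (0 : R) 1 (fun t : R => qf u (cmxfun (horner p) (A + t%:C *: X))) (qf u D)) /\
    forall d : 'rV[R]_n, A = rdiag d -> forall i j,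
       (d 0 i - d 0 j)%:C * D i j = (p.[d 0 i] - p.[d 0 j])%:C * X i j /\
       (d 0 i = d 0 j -> D i j = (p^`().[d 0 i])%:C * X i j).
Proof.
move=> hA hX; have [N [G [G0 GE Gd]]] := poly_curve p hA hX.
exists (G 1%N); split=> [u|d /Gd[]//].
rewrite (_ : (fun t => _) = horner (\poly_(m < N) qf u (G m))); last first.
  apply/funext => t; rewrite GE qf_sum_mx horner_poly; apply: eq_bigr => m _.
  by rewrite qfZ mulrC.
apply: (is_derive_eq (is_derive_poly _ _)).
rewrite horner_coef0 coef_deriv coef_poly mulr1n; case: ifP => // /negbT.
by rewrite -leqNgt => /G0 ->; rewrite /qf mulmx0 mul0mx mxE raddf0.
Qed.

Lemma sqnorm_mul_udiag n (Q : 'M[C]_n) d (v : 'rV[C]_n) : Q \is unitarymx ->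
  sqnorm (v *m udiag Q d) = \sum_i nsq ((v *m Q^t*) 0 i) * d 0 i ^+ 2.
Proof.
move=> hQ; rewrite -(sqnorm_unitary _ hQ) /udiag -!mulmxA (unitarymxP hQ) mulmx1.
rewrite mulmxA /sqnorm; apply: eq_bigr => i _.
by rewrite mul_rdiag mulrC nsqM mulrC.
Qed.

(** An eigenvector of [A + t X] is an approximate eigenvector of [A], with error
    controlled by [|t|]; for Hermitian matrices this locates the eigenvalue. *)
Lemma eigenvalue_perturb n (A X : 'M[C]_n) : cherm A -> cherm X ->
  exists2 K : R, 0 <= K & forall t x : R, eigenvalue (A + t%:C *: X) x%:C ->
    exists2 a : R, eigenvalue A a%:C & `|x - a| <= K * `|t|.
Proof.
move=> hA hX; have [Q [d [hQ AE _]]] := spectral_decomp hA.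
have [P [e [hP XE _]]] := spectral_decomp hX.
pose K := \sum_i `|e 0 i|; have K0 : 0 <= K by apply: sumr_ge0.
exists K => // t x /eigenvalueP [v hv v0].
have eK i : e 0 i ^+ 2 <= K ^+ 2.
  rewrite -(real_normK (num_real (e 0 i))) lerXn2r ?nnegrE //.
  by rewrite /K (bigD1 i) //= lerDl sumr_ge0.
have [i hi] : exists i, `|x - d 0 i| <= K * `|t|.
  apply/not_existsP => hn.
  have E : v *m udiag Q (d - const_mx x) = - (t%:C *: (v *m X)).
    rewrite -udiagD -AE (_ : - const_mx x = const_mx (- x)); last first.
      by apply/rowP => i; rewrite !mxE.
    rewrite udiag_const // mulmxDr mul_mx_scalar rmorphN scaleNr.
    by move: hv; rewrite mulmxDr -scalemxAr => <-; rewrite opprD addNKr.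
  have S : sqnorm (v *m udiag Q (d - const_mx x)) <= (K * t) ^+ 2 * sqnorm v.
    have sN (w : 'rV[C]_n) : sqnorm (- w) = sqnorm w.
      apply: eq_bigr => i _; have := nsqM (-1) (w 0 i).
      by rewrite rmorphN1 mulN1r sqrrN expr1n mul1r mxE.
    have sZ (w : 'rV[C]_n) : sqnorm (t%:C *: w) = t ^+ 2 * sqnorm w.
      by rewrite /sqnorm mulr_sumr; apply: eq_bigr => i _; rewrite mxE nsqM.
    rewrite E sN sZ XE sqnorm_mul_udiag // -(sqnorm_unitary v hP) exprMn (mulrC (K ^+ 2)).
    rewrite -[leRHS]mulrA ler_wpM2l ?sqr_ge0 // /sqnorm mulr_sumr; apply: ler_sum => i _.
    by rewrite mulrC ler_wpM2r // nsq_ge0.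
  move: S; rewrite sqnorm_mul_udiag // -(sqnorm_unitary v hQ) leNgt => /negP; apply.
  rewrite /sqnorm mulr_sumr.
  have big i : (K * t) ^+ 2 < (d - const_mx x) 0 i ^+ 2.
    rewrite !mxE -(real_normK (num_real (K * t))) -(real_normK (num_real (d 0 i - x))).
    rewrite ltrXn2r ?nnegrE // distrC normrM (ger0_norm K0).
    by rewrite ltNge; apply/negP/hn.
  have : v *m Q^t* != 0.
    apply: contra_neq v0 => h.
    by rewrite -(mulmx1 v) -(unitary_mul1 hQ) mulmxA h mul0mx.
  move=> /rV0Pn [i hi]; rewrite (bigD1 i) //= [ltRHS](bigD1 i) //=.
  apply: ltr_leD.
    by rewrite mulrC ltr_pM2l // lt_def nsq_ge0 nsq_eq0 hi.
  by apply: ler_sum => j _; rewrite mulrC ler_wpM2l ?nsq_ge0 // ltW.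
by exists (d 0 i) => //; rewrite AE; apply/eigenvalue_udiag => //; exists i.
Qed.

(** The eigenvalues of [A + t X] are within [O(t)] of points where [g] vanishes
    to second order, so that all values of [g] on them are [o(t)]. *)
Lemma flat_curve_deriv n (A X : 'M[C]_n) (g : R -> R) : cherm A -> cherm X ->
  (forall a : R, eigenvalue A a%:C -> g a = 0 /\ is_derive a 1 g 0) ->
  forall u : 'rV[C]_n, is_derive (0 : R) 1 (fun t : R => qf u (cmxfun g (A + t%:C *: X))) 0.
Proof.
move=> hA hX hg u; apply/is_derive_epsP => e e0.
have [K K0 hK] := eigenvalue_perturb hA hX.
have [Q [d [hQ AE _]]] := spectral_decomp hA.
pose c := e / ((K + 1) * (sqnorm u + 1)).
have su := sqnorm_ge0 u.
have den : 0 < (K + 1) * (sqnorm u + 1) by rewrite mulr_gt0 // ltr_wpDl.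
have c0 : 0 < c by rewrite divr_gt0.
pose s := [seq d 0 i | i <- enum 'I_n].
have inS (a : R) : eigenvalue A a%:C -> a \in s.
  by rewrite AE eigenvalue_udiag // => -[i /creal_inj ->]; apply: map_f; rewrite mem_enum.
have eigS (a : R) : a \in s -> eigenvalue A a%:C.
  by move=> /mapP[i _ ->]; rewrite AE; apply/eigenvalue_udiag => //; exists i.
have [a r r' rr'|a /eigS /hg [ga /is_derive_epsP/(_ c c0)[r r0 hr]]|r r0 hr] :=
  @common_radius R s (fun a r => forall h, `|h| < r -> `|g (a + h)| <= c * `|h|).
- by move=> H h hr; apply: H; apply: lt_le_trans rr'.
- by exists r => // h /hr; rewrite ga mulr0 !subr0.
exists (r / (K + 1)); first by rewrite divr_gt0 // ltr_wpDl.
move=> h; rewrite ltr_pdivlMr ?ltr_wpDl // => hr'.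
have q0 : qf u (cmxfun g (A + 0%:C *: X)) = 0.
  rewrite rmorph0 scale0r addr0 (@mxfun_ext _ _ _ _ g (fun=> 0)) //.
    by rewrite mxfun_cst // qf_scalar mul0r.
  by move=> x /hg [].
rewrite q0 mulr0 add0r !subr0.
apply: le_trans (@qf_mxfun_bound _ _ _ _ u g (c * (K * `|h|)) _ _) _.
- exact: cherm_line.
- move=> x /hK [a /inS /hr H xa].
  rewrite -(subrK a x) addrC; have xr : `|x - a| < r.
    by apply: le_lt_trans xa _; have := normr_ge0 h; nra.
  by apply: le_trans (H _ xr) _; rewrite ler_pM2l.
have -> : e = c * ((K + 1) * (sqnorm u + 1)) by rewrite divfK // gt_eqF.
clearbody c.
rewrite -!mulrA ler_pM2l // (mulrC `|h|) !mulrA ler_wpM2r //.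
by move: (sqnorm u) su => y y0; nra.
Qed.

(** At a Hermitian [A], Hermite interpolation of [f] on the spectrum reduces the
    derivative of [f (A + t X)] to that of a polynomial. For diagonal [A] the
    derivative is the Loewner matrix of [f] times [X], entrywise. *)
Lemma mxfun_curve_deriv n (A X : 'M[C]_n) (f df : R -> R) : cherm A -> cherm X ->
  (forall a : R, eigenvalue A a%:C -> is_derive a 1 f (df a)) ->
  exists D : 'M[C]_n,
    (forall u : 'rV[C]_n, is_derive (0 : R) 1 (fun t : R => qf u (cmxfun f (A + t%:C *: X))) (qf u D)) /\
    forall d : 'rV[R]_n, A = rdiag d -> forall i j,
       (d 0 i - d 0 j)%:C * D i j = (f (d 0 i) - f (d 0 j))%:C * X i j /\
       (d 0 i = d 0 j -> D i j = (df (d 0 i))%:C * X i j).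
Proof.
move=> hA hX hf; have [Q [d [hQ AE _]]] := spectral_decomp hA.
have [p hp] := hermite_interpolation [seq d 0 i | i <- enum 'I_n] f df.
have pE (a : R) : eigenvalue A a%:C -> p.[a] = f a /\ p^`().[a] = df a.
  rewrite AE eigenvalue_udiag // => -[i /creal_inj ->].
  by apply: hp; apply: map_f; rewrite mem_enum.
have [D [hD hDd]] := poly_curve_deriv p hA hX.
exists D; split=> [u|e Ae i j]; last first.
  have ev k : eigenvalue A (e 0 k)%:C.
    rewrite Ae -udiag1; apply/eigenvalue_udiag; first exact: unitary1.
    by exists k.
  have [fi dfi] := pE _ (ev i); have [fj _] := pE _ (ev j).
  by have := hDd e Ae i j; rewrite fi dfi fj.
pose g x := f x - p.[x].
have fE : f = fun x => p.[x] + g x by apply/funext => x; rewrite /g addrC subrK.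
rewrite (_ : (fun t => _) = (fun t => qf u (cmxfun (horner p) (A + t%:C *: X)) +
    qf u (cmxfun g (A + t%:C *: X)))); last first.
  by apply/funext => t; rewrite {1}fE mxfunD ?qfD //; apply: cherm_line.
have gu : is_derive (0 : R) 1 (fun t : R => qf u (cmxfun g (A + t%:C *: X))) 0.
  apply: flat_curve_deriv => // a /[dup] /hf fa /pE [pa dpa].
  split; first by rewrite /g pa subrr.
  have pd := is_derive_poly p a; rewrite dpa in pd.
  by have := is_deriveB fa pd; rewrite subrr.
by have := is_deriveD (hD u) gu; rewrite addr0.
Qed.
End derivative.

(** * Consequences of the sign of the derivatives *)

Section forward.
Variables (R : realType) (cc : complex_model R).
Local Notation C := (cplx cc).
Local Notation "x %:C" := (@creal R cc x) : ring_scope.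
Local Notation pos := `]0, +oo[.
Implicit Types f : R -> R.

Lemma smooth_is_derive f (k : nat) (x : R) : smooth_on pos f -> 0 < x ->
  is_derive x 1 (derive1n k f) (derive1n k.+1 f x).
Proof.
move=> sm x0; rewrite derive1nS derive1E; apply/derivableP/sm.
by rewrite in_itv /= andbT.
Qed.

Lemma is_derive_shift (f : R -> R) (x c l : R) :
  is_derive (c + x) 1 f l <-> is_derive x 1 (fun t => f (c + t)) l.
Proof.
by split=> /is_derive_epsP h; apply/is_derive_epsP => e /h [d d0 hd]; exists d => // y yd;
  have := hd y yd; rewrite addrA.
Qed.

Lemma spec_pos_line n (A X : 'M[C]_n) (t : R) : cspec pos A -> cpsd X -> 0 <= t ->
  cspec pos (A + t%:C *: X).
Proof.
move=> /spec_posP [hA pA] /psdP [hX pX] t0; apply/spec_posP.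
split=> [|u u0]; first exact: cherm_line.
by rewrite qfD qfZ ltr_pwDl ?pA // mulr_ge0.
Qed.

Lemma spec_pos_near n (A X : 'M[C]_n) : cspec pos A -> cherm X ->
  exists2 r : R, 0 < r & forall t : R, `|t| < r -> cspec pos (A + t%:C *: X).
Proof.
move=> sA hX; have hA := sA.1; have [Q [d [hQ AE _ dpos]]] := spec_inP sA.
have [K K0 hK] := eigenvalue_perturb hA hX.
have [a r r' rr' h|a|r r0 hr] :=
  @common_radius R [seq d 0 i | i <- enum 'I_n] (fun a r => r <= a).
- exact: le_trans h.
- by move=> /mapP[i _ ->]; exists (d 0 i) => //; have := dpos i; rewrite in_itv /= andbT.
exists (r / (K + 1)) => [|t]; first by rewrite divr_gt0 // ltr_wpDl.
rewrite ltr_pdivlMr ?ltr_wpDl // => ht; split=> [|z hz]; first exact: cherm_line.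
have [P [e [hP E _]]] := spectral_decomp (cherm_line t hA hX).
move: (hz); rewrite E eigenvalue_udiag // => -[i zE]; exists (e 0 i) => //.
rewrite in_itv /= andbT; rewrite zE in hz.
have [a] := hK t _ hz; rewrite AE eigenvalue_udiag // => -[j /creal_inj ->].
have := hr (d 0 j) (map_f _ (mem_enum _ _)).
rewrite ler_norml => h1 /andP[h2 _]; have := normr_ge0 t; nra.
Qed.

Lemma line_kth_deriv1 f n (A X : 'M[C]_n) (u : 'rV[C]_n) : smooth_on pos f ->
  cspec pos A -> cherm X ->
  kth_deriv 1 (fun t : R => qf u (cmxfun f (A + t%:C *: X)))
    ('D_1 (fun t : R => qf u (cmxfun f (A + t%:C *: X))) 0).
Proof.
move=> sm sA hX; set phi := (fun t => _); have [r r0 hr] := spec_pos_near sA hX.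
exists r => //; exists (fun j => if j is 0%N then phi else 'D_1 phi).
split=> // -[|//] t _ tr; apply: derivableP.
have [hAt st] := hr t tr.
have [|D [hD _]] := @mxfun_curve_deriv R cc n _ X f (derive1n 1 f) hAt hX.
  move=> a /st [x xpos /creal_inj ->]; apply: (@smooth_is_derive f 0) => //.
  by move: xpos; rewrite in_itv /= andbT.
have := hD u; rewrite (_ : (fun s => _) = (fun s => phi (t + s))); last first.
  by apply/funext => s; rewrite /phi rmorphD scalerDl addrA.
by move=> /is_derive_shift; rewrite addr0 => -[].
Qed.

(** The mean value theorem along the segment from [A] to [B]; [s] is the sign that
    treats the increasing and the decreasing case together. *)
Lemma monotone_of_deriv f (s : R) : smooth_on pos f ->
  (forall n (A X : 'M[C]_n), cspec pos A -> cpsd X -> forall u : 'rV[C]_n,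
     0 <= s * 'D_1 (fun t : R => qf u (cmxfun f (A + t%:C *: X))) 0) ->
  forall n (A B : 'M[C]_n), cspec pos A -> cpsd (B - A) -> forall u : 'rV[C]_n,
     s * qf u (cmxfun f A) <= s * qf u (cmxfun f B).
Proof.
move=> sm hs n A B sA psd u; set X := B - A.
pose phi (t : R) := qf u (cmxfun f (A + t%:C *: X)).
have -> : qf u (cmxfun f A) = phi 0 by rewrite /phi rmorph0 scale0r addr0.
have -> : qf u (cmxfun f B) = phi 1 by rewrite /phi rmorph1 scale1r addrC subrK.
have shift (t : R) : 0 <= t -> (fun h : R => qf u (cmxfun f (A + t%:C *: X + h%:C *: X))) =
    (fun h : R => phi (t + h)).
  by move=> _; apply/funext => h; rewrite /phi rmorphD scalerDl addrA.
have hd (t : R) : 0 <= t -> is_derive t 1 phi ('D_1 (fun h : R => phi (t + h)) 0).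
  move=> t0; have st := spec_pos_line sA psd t0.
  have [r r0 [psi [h0 h1 h2]]] := line_kth_deriv1 u sm st psd.1.
  rewrite -[t in is_derive t]addr0; apply/is_derive_shift.
  rewrite -(shift t t0) -h2; apply: (@near_eq_is_derive _ _ _ (psi 0%N)); last first.
    by apply: h1; rewrite ?normr0.
  by apply: filterS (near_norm_lt (_ : `|0 : R| < r)) => [y yr|]; rewrite ?normr0 ?h0.
apply: (@derive_ge0_le01 R (fun t => s * phi t)
   (fun t => s * 'D_1 (fun h : R => phi (t + h)) 0)) => t /andP[t0 t1].
  exact: (is_deriveZ s (hd t t0)).
by rewrite -(shift t t0); apply: hs => //; apply: spec_pos_line.
Qed.

Lemma scalar_kth_deriv f k (x : R) : smooth_on pos f -> 0 < x ->
  kth_deriv k (fun t => f (x + t)) (derive1n k f x).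
Proof.
move=> sm x0; exists x => //; exists (fun j t => derive1n j f (x + t)).
split=> [t _|j t _|]; [exact: erefl| |by rewrite addr0].
rewrite ltr_norml => /andP[h _].
have xt : 0 < x + t by lra.
exact: (is_derive_shift (derive1n j f) t x _).1 (smooth_is_derive j sm xt).
Qed.

(** Matrices of size one carry the scalar derivatives of [f]. *)
Lemma scalar_deriv_sign f (k : nat) (s : R) (x : R) : smooth_on pos f ->
  (forall n (A X : 'M[C]_n), cspec pos A -> cpsd X -> forall u : 'rV[C]_n,
     0 <= s * qf u (cmxderive1n k (fun t => cmxfun f (A + t%:C *: X)) 0)) ->
  0 < x -> 0 <= s * derive1n k f x.
Proof.
move=> sm hs x0; pose A : 'M[C]_1 := rdiag (const_mx x); pose u : 'rV[C]_1 := const_mx 1.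
have sA : cspec pos A.
  rewrite /A -udiag1; apply: spec_in_udiag; first exact: unitary1.
  by move=> i; rewrite mxE in_itv /= andbT.
have h1 : cherm (1%:M : 'M[C]_1) by rewrite /cherm trmx1 map_mx1.
have p1 : cpsd (1%:M : 'M[C]_1).
  by apply/psdP; split=> // v; rewrite qf1 sqnorm_ge0.
have FE (t : R) : cmxfun f (A + t%:C *: 1%:M) = rdiag (const_mx (f (x + t))).
  rewrite /A rdiag_const scalemx1 -raddfD /= -rmorphD -rdiag_const mxfun_rdiag.
  by rewrite map_const_mx.
have [] := @qf_mxderive1n R cc 1 k (fun t => cmxfun f (A + t%:C *: 1%:M))
  (fun v => sqnorm v * derive1n k f x).
- by move=> t; apply: herm_mxfun; apply: cherm_line; [exact: sA.1|].
- move=> v; apply: (@kth_deriv_ext _ _ (fun t => sqnorm v * f (x + t)) _ _ 1 ltr01) => [t _|].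
    by rewrite FE rdiag_const qf_scalar mulrC.
  by apply: kth_derivZ; apply: scalar_kth_deriv.
move=> _ h; have := hs _ A 1%:M sA p1 u; rewrite h.
by rewrite /sqnorm big_ord1 mxE nsq1 mul1r.
Qed.

Lemma nsqE (z : C) : nsq z = cre z ^+ 2 + cim z ^+ 2.
Proof. by rewrite /nsq creMc cre_conj cim_conj; ring. Qed.

Lemma is_derive_continuous_le f (x l b : R) : is_derive x 1 f l ->
  (forall e : R, 0 < e -> b <= f (x + e)) -> b <= f x.
Proof.
move=> /is_derive_epsP /(_ 1 ltr01) [d d0 hd] hb; rewrite leNgt; apply/negP => bf.
pose m := Num.min d ((b - f x) / (`|l| + 1)).
have l0 := normr_ge0 l.
have m0 : 0 < m by rewrite lt_min d0 divr_gt0 //; lra.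
have m1 : m / 2 < d by have : m <= d by [rewrite ge_min lexx]; lra.
have m2 : m * (`|l| + 1) <= b - f x.
  by rewrite -ler_pdivlMr ?ltr_wpDl // ge_min lexx orbT.
have := hd (m / 2); rewrite gtr0_norm ?divr_gt0 // => /(_ m1).
rewrite ler_norml => /andP[_]; have := hb (m / 2) ltac:(lra).
by have := ler_norm l; nra.
Qed.

(** The off-diagonal entries of a matrix with diagonal [(m, m)] and eigenvalues
    [x], [y] can be absorbed at the cost of an arbitrarily small increase of one
    diagonal entry and a large increase of the other. *)
Lemma op_increasing_midconcave f : smooth_on pos f ->
  (forall n (A B : 'M[C]_n), cspec pos A -> cpsd (B - A) -> forall u : 'rV[C]_n,
     qf u (cmxfun f A) <= qf u (cmxfun f B)) ->
  forall x y, 0 < x -> 0 < y -> f x + f y <= 2 * f ((x + y) / 2).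
Proof.
move=> sm mono x y x0 y0; set m := (x + y) / 2; pose d := (x - y) / 2.
have m0 : 0 < m by rewrite /m; lra.
suff : (f x + f y) / 2 <= f m by lra.
apply: (is_derive_continuous_le (@smooth_is_derive f 0 m sm m0)) => e e0.
(* [Q] is the rotation by 45 degrees, up to a reflection: [Q^* diag(x, y) Q] has
   diagonal [(m, m)] and off-diagonal entries [d]. *)
pose s : R := Num.sqrt (2^-1).
have s2 : s ^+ 2 = 2^-1 by rewrite sqr_sqrtr.
pose Q : 'M[C]_2 := \matrix_(i, j) (if (i == 0) || (j == 0) then s else - s)%:C.
have hQ : Q \is unitarymx.
  have ss : s * s + s * s = 1 by rewrite -expr2 s2; field.
  apply/unitarymxP/matrixP => i j; rewrite !mxE !big_ord_recl big_ord0 !mxE addr0.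
  rewrite !conj_creal -!rmorphM -rmorphD.
  case: i => -[|[|//]] ?; case: j => -[|[|//]] ? //=;
    by rewrite ?mulrN ?mulNr ?opprK ?ss ?subrr ?rmorph1 ?rmorph0.
(* The least [L] for which [diag(m + e, L)] dominates that matrix. *)
pose L := m + d ^+ 2 / e.
pose dY : 'rV[R]_2 := \row_i (if i == 0 then x else y).
pose dD : 'rV[R]_2 := \row_i (if i == 0 then m + e else L).
have w0 (u : 'rV[C]_2) : nsq ((u *m Q^t*) 0 0) = 2^-1 * nsq (u 0 0 + u 0 1).
  rewrite mxE !big_ord_recl big_ord0 addr0 !mxE !conj_creal /= -mulrDl.
  by rewrite mulrC nsqM s2; congr (_ * nsq (_ + u 0 _)); apply/val_inj.
have w1 (u : 'rV[C]_2) : nsq ((u *m Q^t*) 0 1) = 2^-1 * nsq (u 0 0 - u 0 1).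
  rewrite mxE !big_ord_recl big_ord0 addr0 !mxE !conj_creal /= rmorphN mulrN -mulrBl.
  by rewrite mulrC nsqM s2; congr (_ * nsq (_ - u 0 _)); apply/val_inj.
have sum2 (F : 'I_2 -> R) : \sum_i F i = F 0 + F 1.
  by rewrite !big_ord_recl big_ord0 addr0; congr (_ + F _); apply/val_inj.
have sY : cspec pos (udiag Q dY).
  by apply: spec_in_udiag => // i; rewrite mxE in_itv /= andbT; case: ifP.
have psd : cpsd (rdiag dD - udiag Q dY).
  apply/psdP; split=> [|u].
    rewrite /cherm adjD adj_rdiag -[in RHS](adj_udiag Q dY); congr (_ + _).
    by apply/matrixP => i j; rewrite !mxE rmorphN.
  rewrite qfB qf_rdiag qf_udiag !sum2 w0 w1 !mxE /= !nsqE !raddfD !raddfN /=.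
  move: (cre (u 0 0)) (cim (u 0 0)) (cre (u 0 1)) (cim (u 0 1)) => a1 a2 b1 b2.
  rewrite -opprD.
  have -> : (a1 ^+ 2 + a2 ^+ 2) * (m + e) + (b1 ^+ 2 + b2 ^+ 2) * L -
    (2^-1 * ((a1 + b1) ^+ 2 + (a2 + b2) ^+ 2) * x +
     2^-1 * ((a1 - b1) ^+ 2 + (a2 - b2) ^+ 2) * y) =
    ((e * a1 - d * b1) ^+ 2 + (e * a2 - d * b2) ^+ 2) / e.
    by rewrite /L /m /d; field; rewrite gt_eqF.
  by rewrite divr_ge0 ?addr_ge0 ?sqr_ge0 // ltW.
have := mono _ _ _ sY psd (delta_mx 0 0).
rewrite mxfun_udiag // mxfun_rdiag qf_rdiag qf_udiag !sum2 w0 w1 !mxE /=.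
by rewrite subr0 addr0 nsq1 nsq0; lra.
Qed.
End forward.

(** * Loewner matrices of a decreasing function *)

Section loewner.
Variables (R : realType) (cc : complex_model R).
Local Notation C := (cplx cc).
Local Notation "x %:C" := (@creal R cc x) : ring_scope.
Local Notation pos := `]0, +oo[.
Implicit Types f g : R -> R.

(** First divided differences of [g], with [dg] as derivative on coinciding nodes. *)
Definition loewner_mx n (g dg : R -> R) (p : 'rV[R]_n) : 'M[C]_n :=
  \matrix_(i, j) (if p 0 i == p 0 j then dg (p 0 i)
                  else (g (p 0 i) - g (p 0 j)) / (p 0 i - p 0 j))%:C.

Lemma loewner_deriv n (g dg : R -> R) (p : 'rV[R]_n) (u : 'rV[C]_n) :
  (forall i, is_derive (p 0 i) 1 g (dg (p 0 i))) ->
  is_derive (0 : R) 1 (fun t : R => qf u (cmxfun g (rdiag p + t%:C *: const_mx 1)))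
    (qf u (loewner_mx g dg p)).
Proof.
move=> hg; have hA : cherm (rdiag p : 'M[C]_n) by exact: adj_rdiag.
have hX : cherm (const_mx 1 : 'M[C]_n).
  by apply/matrixP => i j; rewrite !mxE rmorph1.
have [|D [hD Dd]] := @mxfun_curve_deriv R cc n _ _ g dg hA hX.
  move=> a; rewrite -udiag1 eigenvalue_udiag; last exact: unitary1.
  by move=> [i /creal_inj ->].
suff -> : loewner_mx g dg p = D by [].
apply/matrixP => i j; have [h1 h2] := Dd p erefl i j; rewrite !mxE in h1 h2 *.
case: eqVneq => [pp|pp]; first by rewrite h2 // mulr1.
have pp' : (p 0 i - p 0 j)%:C != 0.
  by rewrite rmorphB subr_eq0 (inj_eq (@creal_inj R cc)).
by apply: (mulfI pp'); rewrite h1 mulr1 -rmorphM mulrC divfK // subr_eq0.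
Qed.

Lemma mxfun_shift n (A : 'M[C]_n) f (d : R) : cherm A ->
  cmxfun (fun x => f (x + d)) A = cmxfun f (A + d%:C%:M).
Proof.
move=> /spectral_decomp [Q [e [hQ AE ->]]].
rewrite AE -(udiag_const d hQ) udiagD mxfun_udiag //.
by congr udiag; apply/rowP => i; rewrite !mxE.
Qed.

Lemma herm_gram m n (Z : 'M[C]_(m, n)) : cherm (Z^t* *m Z).
Proof. by rewrite /cherm adjM trmxCK. Qed.

Lemma qf_gram m n (Z : 'M[C]_(m, n)) (v : 'rV[C]_n) : qf v (Z^t* *m Z) = sqnorm (v *m Z^t*).
Proof. by rewrite -qf1 -qf_conj mulmx1 trmxCK. Qed.

Lemma psd_ones n : cpsd (const_mx 1 : 'M[C]_n).
Proof.
have -> : const_mx 1 = (const_mx 1 : 'M[C]_(1, n))^t* *m const_mx 1 :> 'M[C]_n.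
  by apply/matrixP => i j; rewrite !mxE big_ord1 !mxE rmorph1 mulr1.
by apply/psdP; split=> [|u]; [exact: herm_gram|rewrite qf_gram sqnorm_ge0].
Qed.

Lemma spec_pos_rdiag n (p : 'rV[R]_n) : (forall i, 0 < p 0 i) ->
  cspec pos (rdiag p : 'M[C]_n).
Proof.
move=> h; rewrite -udiag1; apply: spec_in_udiag; first exact: unitary1.
by move=> i; rewrite in_itv /= andbT.
Qed.

Lemma decreasing_qf f n (A B : 'M[C]_n) (u : 'rV[C]_n) : monotone_decreasing_over cc pos f ->
  cspec pos A -> cpsd (B - A) -> qf u (cmxfun f B) <= qf u (cmxfun f A).
Proof.
move=> dec sA psd; have sB : cspec pos B.
  have -> : B = A + 1%:C *: (B - A) by rewrite rmorph1 scale1r addrC subrK.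
  exact: spec_pos_line.
have /psdP [_ /(_ u)] := dec n A B sA sB psd.
by rewrite qfB subr_ge0.
Qed.

Lemma is_derive_translate f (d x : R) : smooth_on pos f -> 0 < x + d ->
  is_derive x 1 (fun y => f (y + d)) (derive1n 1 f (x + d)).
Proof.
move=> sm xd; rewrite (_ : (fun y => f (y + d)) = fun y => f (d + y)); last first.
  by apply/funext => y; rewrite addrC.
have h := @smooth_is_derive R f 0 _ sm xd; rewrite addrC in h.
by rewrite (addrC x); exact: (is_derive_shift f x d _).1 h.
Qed.

(** The Loewner matrix is the derivative of [f (P + d + t J)] at [t = 0], where [J]
    has all entries [1] and is positive semidefinite. *)
Lemma loewner_decreasing f (d : R) n (p : 'rV[R]_n) (u : 'rV[C]_n) : smooth_on pos f ->
  monotone_decreasing_over cc pos f -> 0 <= d -> (forall i, 0 < p 0 i) ->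
  qf u (loewner_mx (fun x => f (x + d)) (fun x => derive1n 1 f (x + d)) p) <= 0.
Proof.
move=> sm dec d0 p0; rewrite -oppr_ge0.
have hd i : is_derive (p 0 i) 1 (fun x => f (x + d)) (derive1n 1 f (p 0 i + d)).
  by apply: is_derive_translate => //; rewrite ltr_wpDr.
have := is_deriveN (@loewner_deriv n (fun x => f (x + d))
  (fun x => derive1n 1 f (x + d)) p u hd).
move=> /is_derive_right_ge0; apply; exists 1 => // t /andP[t0 _].
rewrite /= add0r !fctE lerN2.
have hJ := psd_ones n; have sA := spec_pos_rdiag p0.
have hB (s : R) : 0 <= s -> cherm (rdiag p + s%:C *: const_mx 1 : 'M[C]_n).
  by move=> s0; apply: cherm_line; [exact: adj_rdiag | exact: hJ.1].
rewrite !mxfun_shift; try exact: hB.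
all: try by apply: hB; rewrite ?ltW.
apply: decreasing_qf => //.
  rewrite rmorph0 scale0r addr0 -rdiag_const /rdiag -raddfD -map_mxD /=.
  apply: spec_pos_rdiag => i; rewrite !mxE; exact: ltr_wpDr.
have -> : rdiag p + t%:C *: const_mx 1 + d%:C%:M -
   (rdiag p + 0%:C *: const_mx 1 + d%:C%:M) = t%:C *: const_mx 1 :> 'M[C]_n.
  rewrite rmorph0 scale0r addr0 opprD addrACA subrr addr0 addrAC subrr add0r.
  exact: erefl.
have /psdP [h1 h2] := hJ; apply/psdP; split=> [|v].
  by rewrite /cherm adjZ conj_creal h1.
by rewrite qfZ mulr_ge0 // ltW.
Qed.

Lemma cimM (a : R) (z : C) : cim (a%:C * z) = a * cim z.
Proof.
have h : Num.conj (a%:C * z) = a%:C * Num.conj z by rewrite rmorphM /= conj_creal.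
have ci (w : C) : cim w = cre (cpair 0 (- 1) * w).
  by rewrite creMc cre_cpair cim_cpair; ring.
by rewrite !ci mulrCA creM.
Qed.

Lemma peter_paul (p e s : R) (x y : C) : 0 < p -> 0 < e ->
  nsq ((Num.sqrt p)%:C * x + s%:C * y) <=
  (p + e) * nsq x + (s ^+ 2 + s ^+ 2 * p / e) * nsq y.
Proof.
move=> p0 e0; rewrite !nsqE !raddfD /= !creM !cimM.
have : Num.sqrt p ^+ 2 = p by rewrite sqr_sqrtr ?ltW.
move: (Num.sqrt p) (cre x) (cim x) (cre y) (cim y) => q a1 a2 b1 b2 qp.
rewrite -subr_ge0 -qp.
have -> : (q ^+ 2 + e) * (a1 ^+ 2 + a2 ^+ 2) +
  (s ^+ 2 + s ^+ 2 * q ^+ 2 / e) * (b1 ^+ 2 + b2 ^+ 2) -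
  ((q * a1 + s * b1) ^+ 2 + (q * a2 + s * b2) ^+ 2) =
  ((e * a1 - s * q * b1) ^+ 2 + (e * a2 - s * q * b2) ^+ 2) / e.
  by field; rewrite gt_eqF.
by rewrite divr_ge0 ?addr_ge0 ?sqr_ge0 // ltW.
Qed.

(** With [Z = (sqrt P, s 1)] the matrices [Z Z^* = P + s^2 J] and [Z^* Z] share
    their functional calculus through [Z], and [Z^* Z] lies below a diagonal
    matrix whose first [n] entries exceed those of [P] by [e] only. The shift by
    [d] makes the singular [Z^* Z] positive. As [f] decreases, conjugating
    [f (Z^* Z + d)] by [Z] bounds [B f(B + d)] from below, where [B = Z Z^*]; the
    last diagonal entry is dropped because [f] is nonnegative. *)
Lemma mul_id_increasing f (d e s : R) n (p : 'rV[R]_n) (u : 'rV[C]_n) :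
  monotone_decreasing_over cc pos f -> (forall x, 0 < x -> 0 <= f x) ->
  0 < d -> 0 < e -> (forall i, 0 < p 0 i) ->
  \sum_i nsq (u 0 i) * (p 0 i * f (p 0 i + d + e)) <=
  qf u (cmxfun (fun x => x * f (x + d)) (rdiag p + (s ^+ 2)%:C *: const_mx 1)).
Proof.
move=> dec fpos d0 e0 p0.
pose Z : 'M[C]_(n, n + 1) := row_mx (rdiag (map_mx Num.sqrt p)) (const_mx s%:C).
(* The last diagonal entry collects what [peter_paul] costs in each coordinate. *)
pose L := \sum_i (s ^+ 2 + s ^+ 2 * p 0 i / e).
have L0 : 0 <= L.
  apply: sumr_ge0 => i _; apply: addr_ge0; first exact: sqr_ge0.
  by apply: divr_ge0; [apply: mulr_ge0; [exact: sqr_ge0|exact: ltW]|exact: ltW].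
set B := rdiag p + _.
have ZZ : Z *m Z^t* = B.
  rewrite /Z tr_row_mx map_col_mx mul_row_col; congr (_ + _).
    rewrite -[X in _ *m X]/((rdiag _)^t* ) adj_rdiag rdiagM; congr rdiag.
    by apply/rowP => i; rewrite !mxE -expr2 sqr_sqrtr ?ltW.
  apply/matrixP => i j; rewrite !mxE big_ord1 !mxE conj_creal mulr1.
  by rewrite -rmorphM -expr2.
have hB : cherm B by rewrite -ZZ -{1}(trmxCK Z); apply: herm_gram.
have hG := herm_gram Z.
pose Y := Z^t* *m Z + d%:C%:M.
have sq v : sqnorm (v *m Z^t*) >= 0 := sqnorm_ge0 _.
have dI m : cherm (d%:C%:M : 'M[C]_m) by rewrite -rdiag_const /cherm adj_rdiag.
have sY : cspec pos Y.
  apply/spec_posP; split=> [|v v0]; first by rewrite /cherm adjD hG dI.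
  by rewrite qfD qf_gram qf_scalar ltr_wpDl // mulr_gt0 // sqnorm_gt0.
pose D : 'rV[R]_(n + 1) := row_mx (p + const_mx (d + e)) (const_mx (L + d)).
have psd : cpsd (rdiag D - Y).
  apply/psdP; split=> [|v].
    rewrite /cherm adjD adj_rdiag; congr (_ + _).
    have := sY.1; rewrite /cherm => h; rewrite -[in RHS]h.
    by apply/matrixP => i j; rewrite !mxE rmorphN.
  rewrite qfB qf_rdiag qfD qf_gram qf_scalar /sqnorm mulr_sumr.
  pose x : 'rV[C]_n := lsubmx v; pose y : C := v 0 (rshift n 0).
  have -> : \sum_i nsq ((v *m Z^t*) 0 i) =
      \sum_i nsq ((Num.sqrt (p 0 i))%:C * x 0 i + s%:C * y).
    apply: eq_bigr => i _; congr nsq; rewrite -[v]hsubmxK /Z tr_row_mx map_col_mx.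
    rewrite mul_row_col mxE -[X in _ *m X]/((rdiag _)^t* ) adj_rdiag mul_rdiag !mxE.
    by rewrite big_ord1 !mxE conj_creal mulrC (mulrC _ s%:C).
  rewrite !big_split_ord /= !big_ord1.
  under eq_bigr => i _ do rewrite row_mxEl !mxE.
  rewrite row_mxEr mxE.
  rewrite subr_ge0 -/y.
  have S1 : \sum_i nsq ((Num.sqrt (p 0 i))%:C * x 0 i + s%:C * y) <=
      \sum_i (p 0 i + e) * nsq (x 0 i) + L * nsq y.
    rewrite /L mulr_suml -big_split; apply: ler_sum => i _; exact: peter_paul.
  have S2 : \sum_i nsq (v 0 (lshift 1 i)) * (p 0 i + (d + e)) =
      \sum_i (p 0 i + e) * nsq (x 0 i) + \sum_i d * nsq (v 0 (lshift 1 i)).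
    by rewrite -big_split; apply: eq_bigr => i _; rewrite /x mxE /=; ring.
  rewrite S2 mulrDr (mulrC _ L) (mulrC _ d); lra.
have := decreasing_qf (u *m Z) dec sY psd.
have itw : Z *m cmxfun f Y = cmxfun f (B + d%:C%:M) *m Z.
  apply: mxfun_intertwine; [exact: sY.1 | by rewrite /cherm adjD hB dI |].
  by rewrite mulmxDr mulmxDl -ZZ mulmxA mul_mx_scalar mul_scalar_mx.
rewrite -(qf_conj u Z (cmxfun f Y)) itw -mulmxA ZZ -(mxfun_shift f d hB).
have -> : cmxfun (fun x => f (x + d)) B *m B = cmxfun (fun x => f (x + d) * x) B.
  by rewrite mxfunM // mxfun_id.
rewrite mxfun_rdiag qf_rdiag big_split_ord /= big_ord1 => H.
rewrite (_ : (fun x => x * f (x + d)) = (fun x => f (x + d) * x)); last first.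
  by apply/funext => x; rewrite mulrC.
apply: le_trans H; rewrite -[leLHS]addr0; apply: lerD.
  apply: ler_sum => i _; rewrite [map_mx f D 0 _]mxE /D row_mxEl
    [(p + _) 0 i]mxE [const_mx _ _ _]mxE addrA.
  have -> : (u *m Z) 0 (lshift 1 i) = (Num.sqrt (p 0 i))%:C * u 0 i.
    by rewrite /Z mul_mx_row row_mxEl mul_rdiag mxE mulrC.
  by rewrite nsqM sqr_sqrtr ?(ltW (p0 i)) // mulrCA mulrA.
by rewrite mulr_ge0 ?nsq_ge0 // [map_mx f D 0 _]mxE /D row_mxEr
  [const_mx _ _ _]mxE fpos // ltr_wpDl.
Qed.

(** The limit [e -> 0] of the previous comparison, with [s = sqrt t], says that
    [x f(x + d)] increases from [P] to [P + t J]; then differentiate at [t = 0]. *)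
Lemma loewner_mul_id f (d : R) n (p : 'rV[R]_n) (u : 'rV[C]_n) : smooth_on pos f ->
  monotone_decreasing_over cc pos f -> (forall x, 0 < x -> 0 <= f x) ->
  0 < d -> (forall i, 0 < p 0 i) ->
  0 <= qf u (loewner_mx (fun x => x * f (x + d))
               (fun x => f (x + d) + x * derive1n 1 f (x + d)) p).
Proof.
move=> sm dec fpos d0 p0; set h := (fun x => x * f (x + d)).
have hf i : is_derive (p 0 i) 1 (fun x => f (x + d)) (derive1n 1 f (p 0 i + d)).
  by apply: is_derive_translate => //; rewrite addr_gt0.
have hd i : is_derive (p 0 i) 1 h (f (p 0 i + d) + p 0 i * derive1n 1 f (p 0 i + d)).
  have hM := is_deriveM (is_derive_id (p 0 i) 1) (hf i).
  by apply: (is_derive_eq hM); rewrite /GRing.scale /= mulr1 addrC.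
apply: is_derive_right_ge0 (@loewner_deriv n h
  (fun x => f (x + d) + x * derive1n 1 f (x + d)) p u hd) _; exists 1 => // t /andP[t0 _].
rewrite add0r rmorph0 scale0r addr0 mxfun_rdiag qf_rdiag.
rewrite -(sqr_sqrtr (ltW t0)).
pose psi (e : R) := - \sum_i nsq (u 0 i) * (p 0 i * f (p 0 i + d + e)).
have E0 : - \sum_i nsq (u 0 i) * (map_mx h p) 0 i = psi 0.
  by congr (- _); apply: eq_bigr => i _; rewrite mxE addr0.
rewrite -lerN2 E0.
pose F i (e : R) := nsq (u 0 i) * (p 0 i * f (p 0 i + d + e)).
have hF i : is_derive (0 : R) 1 (F i)
    (nsq (u 0 i) * (p 0 i * derive1n 1 f (p 0 i + d))).
  have pd : 0 < p 0 i + d by rewrite addr_gt0.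
  have h0 := @smooth_is_derive R f 0 _ sm pd; rewrite -[X in is_derive X]addr0 in h0.
  have h1 := (is_derive_shift f 0 (p 0 i + d) _).1 h0.
  exact: (is_deriveZ _ (is_deriveZ _ h1)).
have hpsi := is_deriveN (is_derive_sum hF).
have psiE : psi = - \sum_(i < n) F i.
  by apply/funext => e; rewrite /psi !fctE fct_sumE.
rewrite -psiE in hpsi; apply: (is_derive_continuous_le hpsi) => e e0.
by rewrite add0r /psi lerN2; apply: mul_id_increasing.
Qed.
End loewner.
Arguments loewner_mx {R cc n}.

(** * Rational interpolation from two Loewner matrices *)

Section pencil.
Variables (R : realType) (cc : complex_model R).
Local Notation C := (cplx cc).
Local Notation "x %:C" := (@creal R cc x) : ring_scope.
Local Notation pos := `]0, +oo[.

Lemma cpsd_conj m n (L : 'M[C]_n) (T : 'M[C]_(m, n)) : cpsd L ->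
  cpsd (T *m L *m T^t*).
Proof.
move=> /psdP [hL pL]; apply/psdP; split=> [|u]; last by rewrite qf_conj.
by rewrite /cherm !adjM trmxCK hL mulmxA.
Qed.

Lemma psd_spectral n (L : 'M[C]_n) : cpsd L -> exists Q : 'M[C]_n, exists d : 'rV[R]_n,
  [/\ Q \is unitarymx, L = udiag Q d & forall i, 0 <= d 0 i].
Proof.
move=> /psdP [hL pL]; have [Q [d [hQ LE _]]] := spectral_decomp hL.
by exists Q, d; split=> // i; rewrite -(udiag_qf_row d i hQ) -LE.
Qed.

Lemma psd_kernel n (L : 'M[C]_n) (x : 'rV[C]_n) : cpsd L -> qf x L = 0 -> x *m L = 0.
Proof.
move=> /psd_spectral [Q [d [hQ -> d0]]]; rewrite qf_udiag => /eqP.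
rewrite psumr_eq0 => [/allP h|i _]; last by rewrite mulr_ge0 ?nsq_ge0.
rewrite /udiag !mulmxA (_ : x *m Q^t* *m rdiag d = 0) ?mul0mx //.
apply/rowP => i; rewrite mul_rdiag [RHS]mxE; have := h i (mem_index_enum _).
rewrite /= mulf_eq0 nsq_eq0 => /orP[/eqP->|/eqP->]; first by rewrite mul0r.
by rewrite rmorph0 mulr0.
Qed.

Lemma adj_unitary_r n (W : 'M[C]_n) (A B : 'M[C]_n) : W \is unitarymx ->
  A *m W^t* *m (W *m B) = A *m B.
Proof. by move=> hW; rewrite -!mulmxA (mulmxA (W^t* )) unitary_mul1 // mul1mx. Qed.

(** Write [K = L + S] as [Cs Cs^*] and diagonalize the compression of [L] to the
    range of [K]. As [K] may be singular, the congruence [T] has no inverse in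
    general; instead [T^* E^*] is a projection that fixes [T] and the diagonal. *)
Lemma psd_pair_diag n (L S : 'M[C]_n) : cpsd L -> cpsd S ->
  exists T E : 'M[C]_n, exists d : 'rV[R]_n, [/\ forall i, 0 <= d 0 i <= 1,
    L = T *m rdiag d *m T^t*, S = T *m (1%:M - rdiag d) *m T^t*,
    T *m (T^t* *m E^t*) = T & rdiag d *m (T^t* *m E^t*) = rdiag d].
Proof.
move=> pL pS; set K := L + S.
have [hL qL] := (psdP _).1 pL; have [hS qS] := (psdP _).1 pS.
have pK : cpsd K.
  by apply/psdP; split=> [|u]; [rewrite /cherm adjD hL hS | rewrite qfD addr_ge0].
have [Q [k [hQ KE k0]]] := psd_spectral pK.
have QQ := unitarymxP hQ; have QQ' := unitary_mul1 hQ.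
pose a := map_mx Num.sqrt k; pose b := map_mx (fun x => (Num.sqrt x)^-1) k.
pose j := map_mx (fun x : R => (x != 0)%:R) k : 'rV[R]_n.
have ab : rdiag a *m rdiag b = rdiag j :> 'M[C]_n.
  rewrite rdiagM; congr rdiag; apply/rowP => i; rewrite !mxE.
  have [->|ki] := eqVneq (k 0 i) 0; first by rewrite sqrtr0 mul0r.
  by rewrite mulfV // sqrtr_eq0 -ltNge lt_def ki k0.
have aj : rdiag a *m rdiag j = rdiag a :> 'M[C]_n.
  rewrite rdiagM; congr rdiag; apply/rowP => i; rewrite !mxE.
  by have [->|ki] := eqVneq (k 0 i) 0; rewrite ?sqrtr0 ?mul0r ?mulr1 //.
have jb : rdiag j *m rdiag b = rdiag b :> 'M[C]_n.
  rewrite rdiagM; congr rdiag; apply/rowP => i; rewrite !mxE.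
  by have [->|ki] := eqVneq (k 0 i) 0; rewrite ?sqrtr0 ?invr0 ?mul0r ?mul1r.
have aa : rdiag a *m rdiag a = rdiag k :> 'M[C]_n.
  rewrite rdiagM; congr rdiag; apply/rowP => i; rewrite !mxE -expr2 sqr_sqrtr //.
have ba : rdiag b *m rdiag a = rdiag j :> 'M[C]_n.
  by rewrite -[RHS]ab !rdiagM; congr rdiag; apply/rowP => i; rewrite !mxE mulrC.
pose Cs := Q^t* *m rdiag a; pose Ci := rdiag b *m Q.
have Csa : Cs^t* = rdiag a *m Q by rewrite /Cs adjM trmxCK adj_rdiag.
have Cia : Ci^t* = Q^t* *m rdiag b by rewrite /Ci adjM adj_rdiag.
have KC : K = Cs *m Cs^t*.
  by rewrite Csa KE /udiag /Cs -aa -!mulmxA.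
have CiCs : Ci *m Cs = rdiag j.
  by rewrite /Ci /Cs -mulmxA (mulmxA Q) QQ mul1mx ba.
have CsCi : Cs *m Ci = Q^t* *m rdiag j *m Q.
  by rewrite /Ci /Cs -mulmxA (mulmxA (rdiag a)) ab mulmxA.
have bj : rdiag b *m rdiag j = rdiag b :> 'M[C]_n.
  by rewrite -[RHS]jb !rdiagM; congr rdiag; apply/rowP => i; rewrite !mxE mulrC.
have jQL : rdiag j *m (Q *m L) = Q *m L.
  apply/matrixP => i l; rewrite rdiag_mul [j 0 i]mxE.
  have [ki|ki] := eqVneq (k 0 i) 0; last by rewrite rmorph1 mul1r.
  have -> : (Q *m L) i l = 0; last by rewrite mulr0.
  have q0 : qf (row i Q) L = 0.
    have := udiag_qf_row k i hQ; rewrite -KE qfD ki.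
    by have := qL (row i Q); have := qS (row i Q); lra.
  have := psd_kernel pL q0; rewrite -row_mul => /rowP /(_ l).
  by rewrite mxE [RHS]mxE.
have Csj : Cs *m rdiag j = Cs by rewrite /Cs -mulmxA aj.
clearbody Cs Ci.
have CL : Cs *m Ci *m L = L by rewrite CsCi -!mulmxA jQL mulmxA QQ' mul1mx.
have LC : L *m Ci^t* *m Cs^t* = L.
  by have := congr1 (fun X => X^t*) CL; rewrite !adjM hL mulmxA.
have pM := cpsd_conj Ci pL; pose M := Ci *m L *m Ci^t*; rewrite -/M in pM.
have CMC : Cs *m M *m Cs^t* = L by rewrite /M !mulmxA CL LC.
have Mj : M *m rdiag j = M by rewrite /M Cia -!mulmxA bj.
have [W [d [hW ME d0]]] := psd_spectral pM.
have WW := unitarymxP hW; have WW' := unitary_mul1 hW.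
have DE : rdiag d = W *m M *m W^t*.
  by rewrite ME /udiag !mulmxA WW mul1mx -mulmxA WW mulmx1.
have d1 i : d 0 i <= 1.
  rewrite -(udiag_qf_row d i hW) -ME /M qf_conj.
  apply: le_trans (_ : qf (row i W *m Ci) K <= _).
    by rewrite /K qfD lerDl.
  rewrite -qf_conj KC (_ : Ci *m _ *m _ = rdiag j *m rdiag j); last first.
    by rewrite mulmxA CiCs -mulmxA -adjM CiCs adj_rdiag.
  rewrite rdiagM qf_rdiag.
  apply: le_trans (_ : sqnorm (row i W) <= 1).
    apply: ler_sum => l _; rewrite [X in _ * X]mxE [j 0 l]mxE.
    by case: eqP => _; rewrite ?mulr1 // !mulr0 nsq_ge0.
  have := udiag_qf_row (const_mx 1) i hW.
  by rewrite udiag_const // qf_scalar mul1r mxE => ->.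
pose T := Cs *m W^t*; pose E := W *m Ci.
have Ta : T^t* = W *m Cs^t* by rewrite /T adjM trmxCK.
have TDT : T *m rdiag d *m T^t* = L.
  by rewrite Ta -CMC ME /udiag /T !mulmxA.
have TT : T *m T^t* = K by rewrite Ta KC /T adj_unitary_r.
have PE : T^t* *m E^t* = W *m rdiag j *m W^t*.
  rewrite Ta /E adjM -!mulmxA; congr (W *m _).
  by rewrite !mulmxA -adjM CiCs adj_rdiag.
exists T, E, d; split.
- by move=> i; rewrite d0 d1.
- by rewrite TDT.
- by rewrite mulmxBr mulmx1 mulmxBl TT TDT /K addrC addKr.
- by rewrite PE /T -(mulmxA W) adj_unitary_r // mulmxA Csj.
- rewrite PE {1}DE -(mulmxA W (rdiag j)) adj_unitary_r // mulmxA.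
  by rewrite -(mulmxA W) Mj -DE.
Qed.

(** For [L] and [S] the Loewner matrices of [- f] and of [x f(x)] at the nodes [p],
    the combination [P L + S] has all rows equal to the values [v] of [f]. In a
    basis that diagonalizes both matrices this reads
    [(p_i d_k + 1 - d_k) T_ik = g_k], so each column of [T] is a Cauchy kernel, and
    [v = g T^*] is the rational function sought. *)
Lemma rational_interpolation n (L S : 'M[C]_n) (p v : 'rV[R]_n) :
  cpsd L -> cpsd S -> (forall i, 0 < p 0 i) ->
  (forall i j, (rdiag p *m L + S) i j = (v 0 j)%:C) ->
  exists w d : 'rV[R]_n, [/\ forall k, 0 <= w 0 k, forall k, 0 <= d 0 k <= 1 &
    forall j, v 0 j = \sum_k w 0 k * (p 0 j * d 0 k + (1 - d 0 k))^-1].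
Proof.
move=> pL pS p0 rel'; have [T [E [d [d01 LE SE TE dE]]]] := psd_pair_diag pL pS.
pose one : 'cV[C]_n := const_mx 1; pose vr : 'rV[C]_n := map_mx creal v.
have rel : rdiag p *m L + S = one *m vr.
  apply/matrixP => i j; by rewrite rel' mxE big_ord1 !mxE mul1r.
pose g : 'rV[C]_n := vr *m E^t*.
have key : rdiag p *m T *m rdiag d + T *m (1%:M - rdiag d) = one *m g.
  have r1 : rdiag p *m L *m E^t* = rdiag p *m T *m rdiag d.
    by rewrite LE -!mulmxA dE.
  have r2 : S *m E^t* = T *m (1%:M - rdiag d).
    by rewrite SE -!mulmxA mulmxBl mul1mx dE !mulmxBr TE mulmx1.
  by rewrite /g mulmxA -rel mulmxDl r1 r2.
clearbody g.
have den i k : 0 < p 0 i * d 0 k + (1 - d 0 k).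
  have := p0 i; have /andP[h0 h1] := d01 k; have [->|] := eqVneq (d 0 k) 0; first lra.
  by move=> hk pi; have : 0 < d 0 k by [rewrite lt_def hk]; nra.
have TE' i k : T i k = (p 0 i * d 0 k + (1 - d 0 k))^-1%:C * g 0 k.
  have /matrixP /(_ i k) := key; rewrite [RHS]mxE big_ord1 [one _ _]mxE mul1r => <-.
  have subE (X Y : 'M[C]_n) : (X - Y) i k = X i k - Y i k by rewrite !mxE.
  rewrite mxE mul_rdiag rdiag_mul mulmxBr mulmx1 subE mul_rdiag.
  have -> : (p 0 i)%:C * T i k * (d 0 k)%:C + (T i k - T i k * (d 0 k)%:C) =
     (p 0 i * d 0 k + (1 - d 0 k))%:C * T i k.
    by rewrite rmorphD rmorphB rmorphM rmorph1; ring.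
  by rewrite mulrA -rmorphM mulVf ?gt_eqF // rmorph1 mul1r.
exists (\row_k nsq (g 0 k)), d; split=> [k||j]; first by rewrite mxE nsq_ge0.
  exact: d01.
have E1 : one *m vr = one *m g *m T^t*.
  by rewrite -rel -key LE SE mulmxDl !mulmxA.
have /matrixP /(_ j j) := E1.
rewrite -mulmxA [LHS]mxE big_ord1 [RHS]mxE big_ord1 [one _ _]mxE !mul1r [vr _ _]mxE.
move=> h; apply: (@creal_inj R cc); rewrite h mxE rmorph_sum /=; apply: eq_bigr => k _.
rewrite !mxE TE' [(_ * g 0 k)^*]rmorphM /= conj_creal mulrCA mulJ_nsq -rmorphM.
by rewrite mulrC.
Qed.
End pencil.

(** * Resolvents as sums of Cauchy kernels *)

Section resolvent.
Variables (R : realType) (cc : complex_model R).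
Local Notation C := (cplx cc).
Local Notation "x %:C" := (@creal R cc x) : ring_scope.
Local Notation pos := `]0, +oo[.

(** The congruence by [B ^ (-1/2)] turns [B] into the identity, after which only one
    Hermitian matrix is left to diagonalize, by a unitary. *)
Lemma pos_pair_diag n (B Y : 'M[C]_n) (K : R) : cspec pos B -> cpsd Y ->
  (forall u, qf u Y <= K * qf u B) ->
  exists T V : 'M[C]_n, exists e : 'rV[R]_n, [/\ T *m V = 1%:M, V *m T = 1%:M,
    B = T^t* *m T, Y = T^t* *m rdiag e *m T & forall i, 0 <= e 0 i <= K].
Proof.
move=> /spec_inP [Q [b [hQ BE _ bpos]]] pY hK.
have b0 i : 0 < b 0 i by have := bpos i; rewrite in_itv /= andbT.
have QQ := unitarymxP hQ; have QQ' := unitary_mul1 hQ.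
pose a := map_mx Num.sqrt b; pose c := map_mx (fun x => (Num.sqrt x)^-1) b.
have ac : rdiag a *m rdiag c = 1%:M :> 'M[C]_n.
  rewrite rdiagM (_ : (\row_i _) = const_mx 1) ?rdiag_const ?rmorph1 //.
  by apply/rowP => i; rewrite !mxE mulfV // sqrtr_eq0 -ltNge.
have aa : rdiag a *m rdiag a = rdiag b :> 'M[C]_n.
  by rewrite rdiagM; congr rdiag; apply/rowP => i; rewrite !mxE -expr2 sqr_sqrtr ?ltW.
pose S := rdiag a *m Q; pose U := Q^t* *m rdiag c.
have SU : S *m U = 1%:M by rewrite /S /U -mulmxA (mulmxA Q) QQ mul1mx ac.
have US : U *m S = 1%:M by rewrite (mulmx1C SU).
have BS : B = S^t* *m S.
  by rewrite BE /S adjM adj_rdiag /udiag -aa !mulmxA.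
clearbody S U.
have SUa : S^t* *m U^t* = 1%:M by rewrite -adjM US trmx1 map_mx1.
have USa : U^t* *m S^t* = 1%:M by rewrite -adjM SU trmx1 map_mx1.
have pM : cpsd (U^t* *m Y *m U) by have := cpsd_conj (U^t* ) pY; rewrite trmxCK.
have [P [e [hP ME e0]]] := psd_spectral pM.
have PP := unitarymxP hP; have PP' := unitary_mul1 hP.
exists (P *m S), (U *m P^t*), e; split.
- by rewrite -mulmxA (mulmxA S) SU mul1mx.
- by rewrite -mulmxA (mulmxA (P^t* )) PP' mul1mx.
- by rewrite adjM -mulmxA (mulmxA (P^t* )) PP' mul1mx.
- have -> : (P *m S)^t* *m rdiag e *m (P *m S) = S^t* *m udiag P e *m S.
    by rewrite adjM /udiag !mulmxA.
  rewrite -ME !mulmxA SUa mul1mx -mulmxA US mulmx1; exact: erefl.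
- move=> i; rewrite e0 /= -(udiag_qf_row e i hP) -ME.
  have qU (X : 'M[C]_n) : qf (row i P) (U^t* *m X *m U) = qf (row i P *m U^t*) X.
    by rewrite -qf_conj trmxCK.
  rewrite qU (le_trans (hK _)) // -qU BS mulmxA USa mul1mx SU.
  have := udiag_qf_row (const_mx 1) i hP.
  by rewrite udiag_const // rmorph1 mxE => ->; rewrite mulr1.
Qed.

Lemma kernel_sum0 (s : seq (R * R)) t :
  kernel_sum 0 s t = \sum_(p <- s) p.1 * (1 + t * p.2)^-1.
Proof.
rewrite /kernel_sum expr0 mul1r mul1r.
by apply: eq_bigr => p _; rewrite expr0 mul1r expr1.
Qed.

(** Diagonalizing [d A + 1 - d] and [d X] together turns the inverse of their
    pencil into a sum of scalars [1 / (1 + t y)]; the bound [X <= K A] is inherited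
    as [y <= K] for every [d], because [d A <= d A + 1 - d]. *)
Lemma resolvent_kernel n (A X : 'M[C]_n) (u : 'rV[C]_n) (K d : R) :
  cspec pos A -> cpsd X -> 0 < K -> (forall v, qf v X <= K * qf v A) -> 0 <= d <= 1 ->
  exists2 s, kernel_valid K s & forall t, `|t| < (2 * K)^-1 ->
    cspec pos (A + t%:C *: X) /\
    qf u (cmxfun (fun x => (x * d + (1 - d))^-1) (A + t%:C *: X)) = kernel_sum 0 s t.
Proof.
move=> sA pX K0 hK /andP[d0 d1].
have [hA qA] := (spec_posP _).1 sA; have [hX qX] := (psdP _).1 pX.
pose B := d%:C *: A + (1 - d)%:C%:M.
have hB : cherm B.
  by rewrite /cherm /B -rdiag_const adjD adjZ conj_creal hA adj_rdiag.
have qB v : qf v B = d * qf v A + (1 - d) * sqnorm v by rewrite qfD qfZ qf_scalar.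
have sB : cspec pos B.
  apply/spec_posP; split=> // v v0; rewrite qB.
  have := qA v v0; have : 0 < sqnorm v by rewrite sqnorm_gt0.
  move: (qf v A) (sqnorm v) => x y y0 x0.
  have [->|dn] := eqVneq d 0; first by rewrite mul0r add0r subr0 mul1r.
  have d0' : 0 < d by rewrite lt_def dn.
  by apply: ltr_pwDl; [exact: mulr_gt0 | rewrite mulr_ge0 ?subr_ge0 // ltW].
have pY : cpsd (d%:C *: X).
  apply/psdP; split=> [|v]; first by rewrite /cherm adjZ conj_creal hX.
  by rewrite qfZ mulr_ge0.
have hY v : qf v (d%:C *: X) <= K * qf v B.
  rewrite qfZ qB; have := ler_wpM2l d0 (hK v).
  have : 0 <= K * ((1 - d) * sqnorm v).
    apply: mulr_ge0; first exact: ltW.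
    by rewrite mulr_ge0 ?sqnorm_ge0 // subr_ge0.
  by move: (qf v X) (qf v A) (sqnorm v) => x y z; lra.
have [T [V [e [TV VT BT YT eK]]]] := pos_pair_diag sB pY hY.
exists [seq (nsq ((u *m V) 0 i), e 0 i) | i <- enum 'I_n].
  by move=> q /mapP[i _ ->] /=; rewrite nsq_ge0.
move=> t ht.
have tK : `|t| * K <= 2^-1.
  have : `|t| * (2 * K) < 1 by rewrite -ltr_pdivlMr ?mulr_gt0 // mul1r.
  by move=> h; rewrite -(ler_pM2l (ltr0Sn _ 1)) mulfV ?pnatr_eq0 //; lra.
have sN : cspec pos (A + t%:C *: X).
  apply/spec_posP; split=> [|v v0]; first exact: cherm_line.
  rewrite qfD qfZ; have := qA v v0; have := qX v; have := hK v.
  move: (qf v A) (qf v X) => x y xy y0 x0.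
  have : - (`|t| * y) <= t * y by have := ler_norm (- t); rewrite normrN; nra.
  have : `|t| * y <= `|t| * (K * x) by rewrite ler_wpM2l.
  by nra.
split=> //; set N := A + t%:C *: X in sN *; set F := cmxfun _ N.
have hN := sN.1.
have den i : 0 < 1 + t * e 0 i.
  have /andP[e0 eK'] := eK i.
  have : - (`|t| * e 0 i) <= t * e 0 i by have := ler_norm (- t); rewrite normrN; nra.
  have : `|t| * e 0 i <= `|t| * K by rewrite ler_wpM2l.
  by lra.
have NT : d%:C *: N + (1 - d)%:C%:M = T^t* *m rdiag (\row_i (1 + t * e 0 i)) *m T.
  rewrite (_ : rdiag _ = 1%:M + t%:C *: rdiag e); last first.
    apply/matrixP => i j; rewrite !mxE; case: eqP => _; rewrite ?mulr1n ?mulr0n.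
      by rewrite rmorphD rmorphM rmorph1.
    by rewrite mulr0 addr0.
  rewrite mulmxDr mulmx1 mulmxDl -scalemxAr -scalemxAl -BT -YT /B /N scalerDr.
  by rewrite !scalerA (mulrC d%:C) addrAC.
have FN : F *m (d%:C *: N + (1 - d)%:C%:M) = 1%:M.
  have -> : d%:C *: N + (1 - d)%:C%:M = cmxfun (fun x => x * d + (1 - d)) N.
    by rewrite mxfunD // mxfunM // mxfun_id // !mxfun_cst // mul_mx_scalar.
  rewrite /F -mxfunM // -(rmorph1 (@creal R cc)) -(mxfun_cst 1 hN).
  apply: mxfun_ext => // x /sN.2 [y ypos /creal_inj ->]; rewrite mulVf //.
  move: ypos; rewrite in_itv /= andbT => y0; rewrite gt_eqF //.
  have [->|dn] := eqVneq d 0; first by rewrite mulr0 add0r subr0.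
  by have : 0 < d; [rewrite lt_def dn | nra].
clearbody F.
have FE : F = V *m rdiag (\row_i (1 + t * e 0 i)^-1) *m V^t*.
  have VTa : T^t* *m V^t* = 1%:M by rewrite -adjM VT trmx1 map_mx1.
  have ri : rdiag (\row_i (1 + t * e 0 i)) *m rdiag (\row_i (1 + t * e 0 i)^-1) =
      1%:M :> 'M[C]_n.
    rewrite rdiagM (_ : (\row_i _) = const_mx 1) ?rdiag_const ?rmorph1 //.
    by apply/rowP => i; rewrite !mxE mulfV // gt_eqF.
  have := congr1 (fun Z => Z *m (V *m rdiag (\row_i (1 + t * e 0 i)^-1) *m V^t*)) FN.
  rewrite mul1mx NT => <-; rewrite -!mulmxA (mulmxA T) TV mul1mx.
  by rewrite (mulmxA (rdiag _)) ri mul1mx VTa mulmx1.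
rewrite FE qf_conj qf_rdiag kernel_sum0 big_map big_enum /=.
by apply: eq_bigr => i _; rewrite mxE.
Qed.
End resolvent.

(** * The two characterizations *)

Section characterizations.
Variables (R : realType) (cc : complex_model R).
Local Notation C := (cplx cc).
Local Notation "x %:C" := (@creal R cc x) : ring_scope.
Local Notation pos := `]0, +oo[.
Implicit Types f : R -> R.

Lemma herm_loewner n (g dg : R -> R) (p : 'rV[R]_n) :
  cherm (loewner_mx g dg p : 'M[C]_n).
Proof.
apply/matrixP => i j; rewrite !mxE conj_creal eq_sym; case: eqP => [->//|_].
by rewrite -opprB -[X in _ / X]opprB invrN mulrNN.
Qed.

Lemma cherm_opp n (A : 'M[C]_n) : cherm A -> cherm (- A).
Proof.
move=> hA; have -> : - A = (-1)%:C *: A by rewrite rmorphN1 scaleN1r.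
by rewrite /cherm adjZ conj_creal hA.
Qed.

Lemma qf_mxfun_sum n (N : 'M[C]_n) (u : 'rV[C]_n) m (w : 'I_m -> R) (r : 'I_m -> R -> R) :
  cherm N -> qf u (cmxfun (fun x => \sum_k w k * r k x) N) =
             \sum_k w k * qf u (cmxfun (r k) N).
Proof.
move=> /spectral_decomp [Q [d [hQ _ h]]]; rewrite h qf_udiag.
under [RHS]eq_bigr => k _ do rewrite h qf_udiag mulr_sumr.
rewrite exchange_big; apply: eq_bigr => i _; rewrite [map_mx _ _ _ _]mxE mulr_sumr.
by apply: eq_bigr => k _; rewrite [map_mx _ _ _ _]mxE mulrCA.
Qed.

Lemma decreasing_rational f (d : R) (s : seq R) : smooth_on pos f ->
  monotone_decreasing_over cc pos f -> (forall x, 0 < x -> 0 <= f x) ->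
  0 < d -> (forall x, x \in s -> 0 < x) ->
  exists m (w e : 'rV[R]_m), [/\ forall k, 0 <= w 0 k, forall k, 0 <= e 0 k <= 1 &
    forall x, x \in s -> f (x + d) = \sum_k w 0 k * (x * e 0 k + (1 - e 0 k))^-1].
Proof.
move=> sm dec fpos d0 s0; pose p : 'rV[R]_(size s) := \row_i s`_i.
have p0 i : 0 < p 0 i by rewrite mxE; apply: s0; rewrite mem_nth.
pose v : 'rV[R]_(size s) := \row_i f (p 0 i + d).
pose df x := derive1n 1 f (x + d).
pose L : 'M[C]_(size s) := loewner_mx (fun x => f (x + d)) df p.
pose S : 'M[C]_(size s) := loewner_mx (fun x => x * f (x + d))
  (fun x => f (x + d) + x * df x) p.
have pL : cpsd (- L).
  apply/psdP; split=> [|u]; first by apply: cherm_opp; apply: herm_loewner.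
  by rewrite qfN oppr_ge0; apply: loewner_decreasing => //; apply: ltW.
have pS : cpsd S.
  by apply/psdP; split=> [|u]; [exact: herm_loewner | exact: loewner_mul_id].
have [|w [e [w0 e01 h]]] := rational_interpolation (v := v) pL pS p0.
  move=> i j; rewrite [LHS]mxE rdiag_mul [(- L) i j]mxE [L i j]mxE [S i j]mxE [v 0 j]mxE.
  rewrite -rmorphN -rmorphM -rmorphD; congr (creal _).
  by case: eqVneq => [->|pij]; [ring | field; rewrite subr_eq0].
exists (size s), w, e; split=> // x xs.
have xi : (index x s < size s)%N by rewrite index_mem.
by have := h (Ordinal xi); rewrite !mxE /= nth_index.
Qed.

(** Finitely many [t] involve finitely many eigenvalues, on which [f (x + d)]
    coincides with a combination of resolvents. *)
Lemma decreasing_curve_kernels f (d : R) n (A X : 'M[C]_n) (K : R) (u : 'rV[C]_n) :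
  smooth_on pos f -> monotone_decreasing_over cc pos f -> (forall x, 0 < x -> 0 <= f x) ->
  0 < d -> cspec pos A -> cpsd X -> 0 < K -> (forall v, qf v X <= K * qf v A) ->
  forall T : seq R, (forall t, t \in T -> `|t| < (2 * K)^-1) ->
  exists2 s, kernel_valid K s & forall t, t \in T ->
    qf u (cmxfun f (A + t%:C *: X + d%:C%:M)) = kernel_sum 0 s t.
Proof.
move=> sm dec fpos d0 sA pX K0 hK T hT.
have hN t : cherm (A + t%:C *: X) by apply: cherm_line; [exact: sA.1 | exact: pX.1].
have rk e := @resolvent_kernel R cc n A X u K e sA pX K0 hK.
have sN t : t \in T -> cspec pos (A + t%:C *: X).
  have [|s _ hs] := rk 0; first by rewrite lexx ler01.
  by move=> /hT /hs [].
have spectra (t : R) : exists l : seq R, forall x : R,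
    eigenvalue (A + t%:C *: X) x%:C <-> x \in l.
  have [Q [e [hQ NE _]]] := spectral_decomp (hN t).
  exists [seq e 0 i | i <- enum 'I_n] => x; rewrite NE eigenvalue_udiag //.
  split=> [[i /creal_inj ->]|/mapP[i _ ->]]; last by exists i.
  by apply: map_f; rewrite mem_enum.
have [eigs heigs] := choice spectra.
pose ps := flatten [seq eigs t | t <- T].
have ps0 x : x \in ps -> 0 < x.
  move=> /flatten_mapP [t tT /heigs hx].
  by have [y] := (sN t tT).2 _ hx; rewrite in_itv /= andbT => y0 /creal_inj ->.
have [m [w [e [w0 e01 h]]]] := decreasing_rational sm dec fpos d0 ps0.
have kernels k : exists s, kernel_valid K s /\ forall t, `|t| < (2 * K)^-1 ->
    qf u (cmxfun (fun x => (x * e 0 k + (1 - e 0 k))^-1) (A + t%:C *: X)) = kernel_sum 0 s t.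
  have [s vs hs] := rk _ (e01 k); exists s; split=> // t /hs [] //.
have [s hs] := choice kernels.
exists (flatten [seq [seq (w 0 k * q.1, q.2) | q <- s k] | k <- enum 'I_m]).
  move=> q /flatten_mapP [k _ /mapP [q' q's ->]] /=.
  by have [q1 q2] := (hs k).1 _ q's; rewrite mulr_ge0.
move=> t tT; rewrite -(mxfun_shift f d (hN t)).
rewrite (@mxfun_ext _ _ _ _ _
  (fun x => \sum_k w 0 k * (x * e 0 k + (1 - e 0 k))^-1)) //; last first.
  by move=> x /heigs xt; apply: h; apply/flatten_mapP; exists t.
rewrite qf_mxfun_sum // kernel_sum0 big_flatten /= big_map big_enum /=.
apply: eq_bigr => k _; rewrite big_map /= ((hs k).2 t (hT t tT)) kernel_sum0.
by rewrite mulr_sumr; apply: eq_bigr => q _; rewrite mulrA.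
Qed.

Lemma decreasing_completely f : smooth_on pos f -> monotone_decreasing_over cc pos f ->
  (forall x, 0 < x -> 0 <= f x) -> completely_monotone_over cc pos f.
Proof.
move=> sm dec fpos n A X sA pX k.
have h1 : cherm (1%:M : 'M[C]_n) by rewrite /cherm trmx1 map_mx1.
have [r r0 hr] := spec_pos_near sA h1.
(* Half of the room that [A] leaves above [0] goes into the shift [d]. *)
pose d := r / 2; have d0 : 0 < d by rewrite divr_gt0.
pose A' := A + (- d)%:C *: 1%:M.
have sA' : cspec pos A' by apply: hr; rewrite normrN gtr0_norm // /d; lra.
have [r' r'0 hr'] := spec_pos_near sA' pX.1.
(* [A' - (r' / 2) X] is still positive, which bounds [X] by a multiple of [A']. *)
pose K := 2 / r'; have K0 : 0 < K by rewrite divr_gt0.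
have hK v : qf v X <= K * qf v A'.
  have [->|v0] := eqVneq v 0.
    by rewrite /qf !mul0mx mxE raddf0 mulr0.
  have /spec_posP [_ /(_ v v0)] : cspec pos (A' + (- (r' / 2))%:C *: X).
    by apply: hr'; rewrite normrN gtr0_norm; lra.
  rewrite qfD qfZ mulNr subr_gt0 => /ltW h.
  have -> : qf v X = K * (r' / 2 * qf v X) by rewrite /K; field; rewrite gt_eqF.
  by rewrite ler_pM2l.
have AE (t : R) : A + t%:C *: X = A' + t%:C *: X + d%:C%:M.
  by rewrite /A' rmorphN scaleNr scalemx1 addrAC subrK.
have hk (u : 'rV[C]_n) : exists c, kth_deriv k (fun t => qf u (cmxfun f (A + t%:C *: X))) c
    /\ 0 <= (-1) ^+ k * c.
  have [T hT|c hc c0] := @kernel_interpolation_deriv R K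
      (fun t => qf u (cmxfun f (A + t%:C *: X))) K0 _ k; last by exists c.
  have [s vs hs] := decreasing_curve_kernels u sm dec fpos d0 sA' pX K0 hK hT.
  by exists s => // t /hs <-; rewrite AE.
have [c hc] := choice hk.
have [|hD qD] := qf_mxderive1n _ (fun u => (hc u).1).
  by move=> t; apply: herm_mxfun; apply: cherm_line; [exact: sA.1 | exact: pX.1].
apply/psdP; split=> [|u]; first by rewrite /cherm adjZ conj_creal hD.
by rewrite qfZ qD; apply: (hc u).2.
Qed.

Lemma deriv1_sign f (s : R) n (A X : 'M[C]_n) : smooth_on pos f ->
  cspec pos A -> cpsd X ->
  (forall u, 0 <= s * qf u (cmxderive1n 1 (fun t => cmxfun f (A + t%:C *: X)) 0)) ->
  forall u : 'rV[C]_n, 0 <= s * 'D_1 (fun t : R => qf u (cmxfun f (A + t%:C *: X))) 0.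
Proof.
move=> sm sA pX h u.
have [|_ hD] := qf_mxderive1n _ (fun v => line_kth_deriv1 v sm sA pX.1).
  by move=> t; apply: herm_mxfun; apply: cherm_line; [exact: sA.1 | exact: pX.1].
by rewrite -hD.
Qed.

Lemma completely_decreasing f : smooth_on pos f -> completely_monotone_over cc pos f ->
  (forall x, 0 < x -> 0 <= f x) /\ monotone_decreasing_over cc pos f.
Proof.
move=> sm cm.
have sgn k n (A X : 'M[C]_n) : cspec pos A -> cpsd X -> forall u : 'rV[C]_n,
    0 <= (-1) ^+ k * qf u (cmxderive1n k (fun t => cmxfun f (A + t%:C *: X)) 0).
  move=> sA pX u; have /psdP [_ /(_ u)] := cm n A X sA pX k.
  by rewrite qfZ.
split=> [x x0|n A B sA sB pBA].
  by have := scalar_deriv_sign sm (sgn 0%N) x0; rewrite expr0 mul1r.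
apply/psdP; split=> [|u].
  have hfA := herm_mxfun f sA.1; have hfB := cherm_opp (herm_mxfun f sB.1).
  by rewrite /cherm adjD hfA hfB.
rewrite qfB subr_ge0.
have := @monotone_of_deriv R cc f (-1) sm _ n A B sA pBA u.
rewrite !mulN1r lerN2; apply=> m A' X sA' pX v.
by apply: deriv1_sign => // z; have := sgn 1%N m A' X sA' pX z; rewrite expr1.
Qed.

Lemma absolutely_affine f : smooth_on pos f -> absolutely_monotone_over cc pos f ->
  exists a b : R, [/\ 0 <= a, 0 <= b & forall x, 0 < x -> f x = a * x + b].
Proof.
move=> sm am.
have sgn k n (A X : 'M[C]_n) : cspec pos A -> cpsd X -> forall u : 'rV[C]_n,
    0 <= 1 * qf u (cmxderive1n k (fun t => cmxfun f (A + t%:C *: X)) 0).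
  by move=> sA pX u; have /psdP [_ /(_ u)] := am n A X sA pX k; rewrite mul1r.
have ge0 k x : 0 < x -> 0 <= derive1n k f x.
  by move=> x0; have := scalar_deriv_sign sm (sgn k) x0; rewrite mul1r.
have mc := op_increasing_midconcave sm.
have [|a [b fE]] := convex_midconcave_affine sm (ge0 2%N).
  apply: mc => n A B sA pBA u.
  have := @monotone_of_deriv R cc f 1 sm _ n A B sA pBA u.
  rewrite !mul1r; apply=> m A' X sA' pX v.
  by apply: deriv1_sign => // z; have := sgn 1%N m A' X sA' pX z.
have f0 x : 0 < x -> 0 <= a * x + b by move=> x0; rewrite -fE //; apply: (ge0 0%N).
have a0 : 0 <= a.
  (* A negative slope would make [a * x + b] negative at this point. *)
  rewrite leNgt; apply/negP => a0; have := f0 ((`|b| + 1) / - a).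
  rewrite divr_gt0 ?oppr_gt0 ?ltr_wpDl // => /(_ isT).
  rewrite invrN mulrN mulrN mulrCA mulfV ?lt_eqF // mulr1.
  by have := ler_norm b; lra.
exists a, b; split=> //; rewrite leNgt; apply/negP => b0.
(* A point so close to [0] that [a * x <= - b / 2]. *)
have := f0 (- b / (2 * (a + 1))).
rewrite divr_gt0 ?oppr_gt0 ?mulr_gt0 ?ltr_wpDl // => /(_ isT).
have : a * (- b / (2 * (a + 1))) <= - b / 2.
  rewrite mulrA ler_pdivrMr ?mulr_gt0 ?ltr_wpDl //; nra.
lra.
Qed.

Lemma affine_absolutely f (a b : R) : 0 <= a -> 0 <= b ->
  (forall x, 0 < x -> f x = a * x + b) -> absolutely_monotone_over cc pos f.
Proof.
move=> a0 b0 fE n A X sA pX k.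
have [hA qA] := (spec_posP _).1 sA; have [hX qX] := (psdP _).1 pX.
have [r r0 hr] := spec_pos_near sA hX.
pose c j (u : 'rV[C]_n) : R := if j is 0%N then a * qf u A + b * sqnorm u else
  if j is 1%N then a * qf u X else 0.
have hk (u : 'rV[C]_n) : kth_deriv k (fun t => qf u (cmxfun f (A + t%:C *: X))) (c k u).
  (* The curve is affine in [t] wherever the spectrum stays positive. *)
  exists r => //; exists (fun j t => if j is 0%N then c 0%N u + c 1%N u * t else c j u).
  split=> [t tr|[|j] t _ tr|].
  - rewrite (@mxfun_ext _ _ _ _ _ (fun x => x * a + b)); last 2 first.
    + exact: cherm_line.
    + move=> x /(hr t tr).2 [y]; rewrite in_itv /= andbT => y0 /creal_inj ->.
      by rewrite fE // mulrC.
    have hN := cherm_line t hA hX.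
    rewrite mxfunD // mxfunM // mxfun_id // !mxfun_cst // mul_mx_scalar.
    by rewrite qfD qfZ qf_scalar qfD qfZ /c; ring.
  - have h1 : is_derive t 1 (fun s : R => c 1%N u * s) (c 1%N u * 1).
      exact: (is_deriveZ _ (is_derive_id t 1)).
    have := is_deriveD (is_derive_cst (c 0%N u) t 1) h1.
    by rewrite add0r mulr1.
  - by case: j => [|j]; apply: is_derive_cst.
  - by case: k => [|k] //=; rewrite mulr0 addr0.
have [|hD qD] := qf_mxderive1n _ hk.
  by move=> t; apply: herm_mxfun; apply: cherm_line.
apply/psdP; split=> // u; rewrite qD; case: k hk hD qD => [|[|k]] _ _ _ //=.
  rewrite addr_ge0 ?mulr_ge0 ?sqnorm_ge0 //.
  by have [->|/qA/ltW//] := eqVneq u 0; rewrite /qf !mul0mx mxE raddf0.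
by rewrite mulr_ge0.
Qed.
End characterizations.

(** * Transfer to the concrete complex numbers *)

Section bridge.
Local Open Scope complex_scope.
Variable R : realType.

Definition std_complex : complex_model R.
Proof.
refine (@ComplexModel R R[i] (real_complex R) (@complex.Re R) (@complex.Im R)
  (fun x y => x +i* y) _ _ _ _ _ _ _ _ _ _ _).
- exact: conjc_real.
- by [].
- by move=> x [a b] /=; rewrite mul0r subr0.
- by move=> [a b] [c d].
- by case.
- by case.
- by move=> [a b] [c d] /= -> ->.
- exact: RRe_real.
- exact: ler0c.
- by [].
- by [].
Defined.
Local Notation C := (cplx std_complex).

Lemma herm_bridge n (A : 'M[R[i]]_n) : (A \is hermsymmx) <-> cherm (A : 'M[C]_n).
Proof. symmetry; exact: (@chermE R std_complex n A). Qed.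

Lemma psd_bridge n (A : 'M[R[i]]_n) : psdmx A <-> cpsd (A : 'M[C]_n).
Proof. by rewrite /psdmx herm_bridge. Qed.

Lemma spec_bridge I n (A : 'M[R[i]]_n) :
  herm_spec_in I A <-> cspec I (A : 'M[C]_n).
Proof. by rewrite /herm_spec_in herm_bridge. Qed.

Lemma op_absolutely_monotone_bridge I f :
  op_absolutely_monotone I f <-> absolutely_monotone_over std_complex I f.
Proof.
split=> H n A X.
  move=> /spec_bridge hA /psd_bridge hX k; apply/psd_bridge; exact: (H n A X hA hX k).
move=> /spec_bridge hA /psd_bridge hX k; apply/psd_bridge; exact: (H n A X hA hX k).
Qed.

Lemma op_completely_monotone_bridge I f :
  op_completely_monotone I f <-> completely_monotone_over std_complex I f.
Proof.
have sgn (k : nat) : creal ((-1) ^+ k) = (-1) ^+ k :> C by rewrite rmorphXn rmorphN1.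
split=> H n A X /spec_bridge hA /psd_bridge hX k.
  by rewrite sgn; apply/psd_bridge; exact: (H n A X hA hX k).
by apply/psd_bridge; have := H n A X hA hX k; rewrite sgn.
Qed.

Lemma op_monotone_decreasing_bridge I f :
  op_monotone_decreasing I f <-> monotone_decreasing_over std_complex I f.
Proof.
split=> H n A B /spec_bridge hA /spec_bridge hB /psd_bridge h; apply/psd_bridge;
  exact: (H n A B hA hB h).
Qed.
End bridge.

Theorem proposition5p7 (R : realType) (f : R -> R)
    (hf : smooth_on `]0, +oo[ f) :
  (op_absolutely_monotone `]0, +oo[ f <->
     exists alpha beta : R, [/\ 0 <= alpha, 0 <= beta &
       forall x : R, 0 < x -> f x = alpha * x + beta]) /\
  (op_completely_monotone `]0, +oo[ f <->
     (forall x : R, 0 < x -> 0 <= f x) /\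
     op_monotone_decreasing `]0, +oo[ f).
Proof.
split; split.
- by move=> /op_absolutely_monotone_bridge /(absolutely_affine hf).
- move=> [a [b [a0 b0 fE]]]; apply/op_absolutely_monotone_bridge.
  exact: affine_absolutely fE.
- move=> /op_completely_monotone_bridge /(completely_decreasing hf) [f0 dec].
  by split=> //; apply/op_monotone_decreasing_bridge.
- move=> [f0 /op_monotone_decreasing_bridge dec].
  by apply/op_completely_monotone_bridge; apply: decreasing_completely.
Qed.
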